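(* Let $a\in[\pi/3,2\pi/5)$, and let $\tilde B_0=\{q_\alpha\}_{\alpha\in\mathbb{C}}$ be the family of potentials described in the context (with a fixed admissible function $g$). Then for each $j\in\{0,1\}$ the spectrum of the boundary value problem $\mathcal{L}_{0,j}(a,q_\alpha)$ is independent of $\alpha\in\mathbb{C}$. Moreover, if $a\in(\pi/3,2\pi/5)$, then $\tilde B_0\subset W_2^1[0,\pi]$.
   Context: For $\nu,j\in\{0,1\}$, $a\in(0,\pi)$ and a complex-valued $q\in L_2(0,\pi)$ with $q(x)=0$ on $(0,a)$, $\mathcal{L}_{\nu,j}(a,q)$ denotes the eigenvalue problem $$-y''(x)+q(x)y(x-a)=\lambda y(x),\quad 0<x<\pi,\qquad y^{(\nu)}(0)=y^{(j)}(\pi)=0.$$ (Since $q=0$ on $(0,a)$, the values of $y$ at negative arguments play no role.) Let $y_0(x,\lambda),y_1(x,\lambda)$ be the unique solutions of the equation with $y_\nu^{(j)}(0,\lambda)=\delta_{\nu,j}$ (Kronecker delta). The spectrum of $\mathcal{L}_{\nu,j}(a,q)$, with account of multiplicity, is the collection of zeros of the entire characteristic function $\Delta_{\nu,j}(\lambda)=y_{1-\nu}^{(j)}(\pi,\lambda)$. $W_2^1[c,d]$ is the Sobolev space of absolutely continuous functions on $[c,d]$ with derivative in $L_2(c,d)$. Put $$h_0(x):=\frac{6\pi^2}{(2\pi-5a)^2}\cos\frac{\pi\sqrt{10}\,(\pi-x)}{2\pi-5a},\qquad e_0(x):=\sin\frac{2\pi(2x-3a)}{2\pi-5a}+2\sin\frac{\pi(2x-3a)}{2\pi-5a},\qquad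 K_{h_0}(x):=\int_x^\pi h_0(\tau)\,d\tau.$$ Let $g\in W_2^1[\pi-a/2,5a/2]$ be an arbitrary fixed function (independent of $\alpha$) satisfying $$g\Big(\pi-\frac a2\Big)=0,\qquad g\Big(\frac{5a}2\Big)=\frac{6\pi^2}{(2\pi-5a)^2}\cos\frac{\pi\sqrt{10}}2.$$ (For $a=\pi/3$ the interval $[\pi-a/2,5a/2)$ is empty, and no function $g$ is involved.) For $\alpha\in\mathbb{C}$ define $$q_\alpha(x)=\begin{cases}0, & x\in[0,\frac{3a}2)\cup[\pi-a,2a),\\ \alpha e_0(x), & x\in[\frac{3a}2,\pi-a),\\ -\alpha K_{h_0}(x+\frac a2)\displaystyle\int_{3a/2}^{x-a/2}e_0(t)\,dt, & x\in[2a,\pi-\frac a2),\\ g(x), & x\in[\pi-\frac a2,\frac{5a}2),\\ h_0(x), & x\in[\frac{5a}2,\pi].\end{cases}$$ *)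

(* Defs.v *)
From HB Require Import structures.
From mathcomp Require Import all_boot all_order all_algebra.
From mathcomp Require Import complex.
From mathcomp Require Import all_classical all_reals all_analysis.
Set Implicit Arguments.
Unset Strict Implicit.
Unset Printing Implicit Defensive.
Import Order.TTheory GRing.Theory Num.Theory.
Import numFieldNormedType.Exports.
Local Open Scope classical_set_scope.
Local Open Scope complex_scope.
Local Open Scope ring_scope.

Section FunctionSpaces.
Variable R : realType.
Implicit Types (c d x : R) (f : R -> R[i]).

(* [l] is the derivative of [f : [c, d] -> C] at [x]; it is one-sided at the
   end points, and values of [f] outside [c, d] are irrelevant. *)
Definition is_deriv_on c d f x (l : R[i]) : Prop :=
  ((z - x)^-1%:C * (f z - f x) : R[i]^o)
    @[z --> within `[c, d] x^'] --> (l : R[i]^o).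

Definition abs_continuous_on c d f : Prop :=
  forall e : R, 0 < e -> exists2 delta : R, 0 < delta &
    forall (n : nat) (u v : 'I_n -> R),
      (forall i, [/\ c <= u i, u i < v i & v i <= d]) ->
      trivIset [set: 'I_n] (fun i => `]u i, v i[%classic) ->
      \sum_(i < n) (v i - u i) < delta ->
      \sum_(i < n) ComplexField.Normc.normc (f (v i) - f (u i)) < e.

Definition L2_on c d f : Prop :=
  [/\ measurable_fun `]c, d[%classic (fun x => complex.Re (f x)),
      measurable_fun `]c, d[%classic (fun x => complex.Im (f x)) &
      (\int[lebesgue_measure]_(x in `]c, d[%classic)
         ((ComplexField.Normc.normc (f x)) ^+ 2)%:E < +oo)%E].

(* The derivative, defined almost everywhere, is an element of L_2(c, d), so
   it is given by one of its representatives [p]. *)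
Definition W21 c d : set (R -> R[i]) :=
  [set f | abs_continuous_on c d f /\
     exists2 p, L2_on c d p &
       {ae lebesgue_measure, forall x,
          x \in `]c, d[ -> is_deriv_on c d f x (p x)}].

End FunctionSpaces.

Section DelayProblem.
Variable R : realType.
Implicit Types (a : R) (q : R -> R[i]) (lam : R[i]) (nu j : 'I_2).

(* Solutions of -y''(x) + q(x) y(x - a) = lam y(x), 0 < x < pi, with
   [Y 0] = y and [Y 1] = y'.  As q vanishes on (0, a), the values of [Y 0] at
   negative arguments are immaterial. *)
Definition delay_solution a q lam (Y : 'I_2 -> R -> R[i]) : Prop :=
  [/\ forall x, x \in `[0, pi] -> is_deriv_on 0 pi (Y 0) x (Y 1 x),
      abs_continuous_on 0 pi (Y 1) &
      {ae lebesgue_measure, forall x, x \in `]0, pi[ ->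
         exists2 y2, is_deriv_on 0 pi (Y 1) x y2 &
           - y2 + q x * Y 0 (x - a) = lam * Y 0 x}].

(* [fund_solution a q lam nu j] is the j-th derivative of y_nu(., lam), which
   is determined on [0, pi] only. *)
Definition fund_solution a q lam nu : 'I_2 -> R -> R[i] :=
  xget (fun _ _ => 0)
    [set Y | delay_solution a q lam Y /\ forall j, Y j 0 = (nu == j)%:R].

(* [1 - nu] is computed in the ring Z/2. *)
Definition char_fun nu j a q : R[i] -> R[i] :=
  fun lam => fund_solution a q lam (1 - nu) j pi.

(* The zeros with account of multiplicity: a zero lam of order m is represented
   by the m pairs (lam, 0), ..., (lam, m - 1). *)
Definition spectrum nu j a q : set (R[i] * nat) :=
  [set p | forall k, (k <= p.2)%N ->
     derive1n k (char_fun nu j a q : R[i]^o -> R[i]^o) p.1 = 0].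

End DelayProblem.

Section Potentials.
Variables (R : realType) (a : R).

Definition h0 (x : R) : R :=
  6 * pi ^+ 2 / (2 * pi - 5 * a) ^+ 2
  * cos (pi * Num.sqrt 10 * (pi - x) / (2 * pi - 5 * a)).

Definition e0 (x : R) : R :=
  sin (2 * pi * (2 * x - 3 * a) / (2 * pi - 5 * a))
  + 2 * sin (pi * (2 * x - 3 * a) / (2 * pi - 5 * a)).

Definition K_h0 (x : R) : R :=
  \int[lebesgue_measure]_(t in `[x, pi]%classic) h0 t.

Definition admissible (g : R -> R[i]) : Prop :=
  [/\ W21 (pi - a / 2) (5 * a / 2) g,
      g (pi - a / 2) = 0 &
      g (5 * a / 2) = (6 * pi ^+ 2 / (2 * pi - 5 * a) ^+ 2
                       * cos (pi * Num.sqrt 10 / 2))%:C].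

Definition q_pot (g : R -> R[i]) (alpha : R[i]) (x : R) : R[i] :=
  if x \in `[3 * a / 2, pi - a[ then alpha * (e0 x)%:C
  else if x \in `[2 * a, pi - a / 2[ then
    - alpha * (K_h0 (x + a / 2))%:C
    * (\int[lebesgue_measure]_(t in `[3 * a / 2, x - a / 2]%classic) e0 t)%:C
  else if x \in `[pi - a / 2, 5 * a / 2[ then g x
  else if x \in `[5 * a / 2, pi] then (h0 x)%:C
  else 0.

Definition B0 (g : R -> R[i]) : set (R -> R[i]) := range (q_pot g).

End Potentials.

(* Main.v *)
Require Import Defs.
From HB Require Import structures.
From mathcomp Require Import all_boot all_order all_algebra.
From mathcomp Require Import complex.
From mathcomp Require Import all_classical all_reals all_analysis.
From mathcomp Require Import measurable_realfun.
From mathcomp Require Import ring lra.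
Set Implicit Arguments.
Unset Strict Implicit.
Unset Printing Implicit Defensive.
Import Order.TTheory GRing.Theory Num.Theory.
Import numFieldNormedType.Exports.
Local Open Scope classical_set_scope.
Local Open Scope complex_scope.
Local Open Scope ring_scope.

(** Why the theorem holds.  Write [b = a / 2] and [l = pi - 5 b], so that
    [0 < l <= b], and let [S], [C] be the solutions of [y'' = - lam y] with
    [S 0 = 0], [S' = C], [C 0 = 1].

    The family is affine, [q_alpha = q_0 + alpha * q_slope], with [q_slope]
    supported in [3 b, pi - b] ([q_pot_affine]).  Let [Y] solve the problem for
    [alpha] with [Y 0 = 0], [Y' 0 = 1].  Potentials vanish on [(0, 3 b)], so
    [Y = S] there, and [Y + (beta - alpha) W] solves the problem for [beta] as
    soon as [W'' + lam W = source], [W 0 = W' 0 = 0], where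
    [source x = q_slope x * S (x - a) + q_0 x * W (x - a)]: the products
    [q_slope x * W (x - a)] drop out because [W] vanishes on [0, 3 b], while
    [q_slope] vanishes beyond [pi - b <= 5 b].  Hence [W] is one function for the
    whole family and the values at [pi] do not depend on [alpha] once
    [W pi = W' pi = 0]; existence of [Y] is never needed, only its uniqueness
    ([shift_delay_solution], [delay_solution_unique], [char_fun_independent]).

    By Duhamel, [W pi = W' pi = 0] says that [source] is orthogonal to every
    solution [U] of [U'' = - lam U] ([source_orthogonal]).  Put
    [e s = e0 (3 b + s)], [E s] its primitive with [E 0 = 0],
    [k s = K_h0 (5 b + s)] and [h = - k'].  The three parts of [source] give
    integrals over [0, l] which integrations by parts turn into
      [A = E l * U (3 b) * S b + int (E l - E s) r s],  [r s = U (4 b + 2 s)],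
      [B = int U (4 b + s) k s E s S (2 b + s)],
      [D = int k s E s S (b + s) U (5 b + s) - int k s R s],
    where [R s = int_0^s E t * r (s - t)], and
    [S (b + s) U (5 b + s) - S (2 b + s) U (4 b + s) = - U (3 b) S b].
    The special choice of [e0] and [h0] enters through [Z s = E l - E (l - s)]:
    it satisfies [Z'' + m^2 Z = c E], [Z 0 = Z' 0 = 0], with the same [m] as in
    [k'' + m^2 k = 0], [k l = 0], [k' l = - c] ([profile_ode]; this is the
    statement that [e0] is fixed by the integral operator with kernel [K_h0]).
    Green's formula for the pairs [(k, Z)] and [(k, Z * r)], [*] being
    convolution, yields [int k E = Z l = E l] and
    [int k R = (Z * r) l = int (E l - E s) r s], so [A - B + D = 0]
    ([green_identity]).

    Solutions are only required to have an absolutely continuous derivative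
    and to satisfy the equation almost everywhere, so uniqueness rests on the
    fact that an absolutely continuous function with derivative zero almost
    everywhere is constant ([ac_deriv0_const]), proved by induction along the
    interval.  The Sobolev statement follows by gluing six pieces, since the
    one-sided values agree at the five break points ([W21_glue],
    [W21_q_pot]). *)

(** * Derivatives of complex-valued functions of a real variable *)

Notation normc := ComplexField.Normc.normc.
Arguments ComplexField.Normc.normc : simpl never.
Section derivatives.
Variable R : realType.
Implicit Types (c d x : R) (f : R -> R[i]).

(** Epsilon-delta form of [is_deriv_on] with an arbitrary domain: [D = [c, d]] gives
    the one-sided derivatives at end points, [D = setT] the usual ones.  The
    bound is multiplied by [`|z - x|], so no punctured neighbourhoods occur. *)
Definition has_deriv (D : set R) f x (l : R[i]) : Prop :=
  forall e : R, 0 < e -> exists2 dl : R, 0 < dl &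
    forall z, D z -> `|z - x| < dl ->
      normc (f z - f x - (z - x)%:C * l) <= e * `|z - x|.

Lemma normcE (z : R[i]) : `|z| = (normc z)%:C.
Proof. by []. Qed.

Lemma normc_real x : normc x%:C = `|x|.
Proof. by rewrite /normc /= expr0n addr0 sqrtr_sqr. Qed.

Lemma is_deriv_onP c d f x l :
  is_deriv_on c d f x l <-> has_deriv `[c, d] f x l.
Proof.
rewrite /is_deriv_on; split.
- move=> /cvgrPdist_lt H e e0.
  have /H : 0 < e%:C :> R[i] by rewrite ltcR.
  rewrite /within /=. move=> /nbhs_ballP [dl /= dl0 Hd].
  exists dl => // z Dz zx.
  have [->|zx0] := eqVneq z x.
    by rewrite !subrr normr0 mulr0 mul0r subr0 ComplexField.Normc.normc0.
  have := Hd z; rewrite /ball /= distrC => /(_ zx zx0 Dz).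
  rewrite normcE ltcR => Hn.
  have -> : f z - f x - (z - x)%:C * l
     = - ((z - x)%:C * (l - (z - x)^-1%:C * (f z - f x))).
    rewrite mulrBr mulrA -rmorphM mulfV ?subr_eq0// mul1r opprB //.
  rewrite normcN ComplexField.Normc.normcM normc_real mulrC.
  by rewrite ler_wpM2r// ltW.
- move=> H; apply/cvgrPdist_lt => e; case: e => e e' /=.
  rewrite ltcE /= => /andP[/eqP-> e0].
  have [|dl dl0 Hd] := H (e / 2); first by rewrite divr_gt0.
  apply/nbhs_ballP; exists dl => //= z zx zx0 Dz.
  rewrite normcE ltcR.
  have := Hd z Dz; rewrite distrC => /(_ zx).
  have -> : f z - f x - (z - x)%:C * l
     = - ((z - x)%:C * (l - (z - x)^-1%:C * (f z - f x))).
    rewrite mulrBr mulrA -rmorphM mulfV ?subr_eq0// mul1r opprB //.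
  rewrite normcN ComplexField.Normc.normcM normc_real mulrC distrC.
  rewrite ler_pM2r ?normr_gt0 ?subr_eq0// => /le_lt_trans; apply.
  by rewrite ltr_pdivrMr// ltr_pMr// ltr1n.
Qed.

Lemma normcB_sym (u v : R[i]) : normc (u - v) = normc (v - u).
Proof. by rewrite -normcN opprB. Qed.

Lemma normc_ge0 (z : R[i]) : 0 <= normc z.
Proof. by case: z => p q; rewrite sqrtr_ge0. Qed.

Lemma normc_triangle (u v w : R[i]) : normc (u - w) <= normc (u - v) + normc (v - w).
Proof. by apply: le_trans (le_normcD _ _); rewrite addrA subrK. Qed.

(** Every estimate below that ends in an arbitrarily small error is closed by this. *)
Lemma eq_of_normc_le (u v : R[i]) (K : R) :
  (forall e : R, 0 < e -> normc (u - v) <= e * K) -> u = v.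
Proof.
move=> H; apply/eqP; rewrite -subr_eq0; apply/eqP.
apply: ComplexField.Normc.eq0_normc; apply/eqP.
rewrite eq_le normc_ge0 andbT; apply/ler_addgt0Pl => e e0; rewrite addr0.
have K0 : 0 < `|K| + 1 by rewrite ltr_wpDl.
have := H (e / (`|K| + 1)); rewrite divr_gt0// => /(_ isT) /le_trans; apply.
rewrite mulrAC ler_pdivrMr// ler_pM2l//.
by rewrite (le_trans (ler_norm _))// lerDl.
Qed.

Definition cont_at (D : set R) f x : Prop :=
  forall e : R, 0 < e -> exists2 dl : R, 0 < dl &
    forall z, D z -> `|z - x| < dl -> normc (f z - f x) <= e.

Lemma has_deriv_cont (D : set R) f x l : has_deriv D f x l -> cont_at D f x.
Proof.
move=> H e e0; have [dl dl0 Hd] := H 1 ltr01.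
have K0 : 0 < 1 + normc l by rewrite ltr_pwDl// normc_ge0.
exists (Num.min dl (e / (1 + normc l))).
  by rewrite lt_min dl0 divr_gt0.
move=> z Dz; rewrite lt_min => /andP[zx1 zx2].
rewrite -(subrK ((z - x)%:C * l) (f z - f x)).
apply: le_trans (le_normcD _ _) _.
rewrite ComplexField.Normc.normcM normc_real.
apply: le_trans (_ : (1 + normc l) * `|z - x| <= _).
  by rewrite mulrDl [normc l * _]mulrC lerD2r Hd.
by rewrite mulrC -ler_pdivlMr// ltW.
Qed.

Lemma has_deriv_sub (D D' : set R) f x l :
  D' `<=` D -> has_deriv D f x l -> has_deriv D' f x l.
Proof.
move=> s H e /H[dl dl0 Hd]; exists dl => // z /s; exact: Hd.
Qed.

Lemma has_deriv_ext (D : set R) f g x l :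
  (exists2 dl : R, 0 < dl & forall z, D z -> `|z - x| < dl -> f z = g z) -> f x = g x ->
  has_deriv D f x l -> has_deriv D g x l.
Proof.
move=> [d1 d10 fg] fgx H e /H[dl dl0 Hd].
exists (Num.min d1 dl); first by rewrite lt_min d10.
move=> z Dz; rewrite lt_min => /andP[zx1 zx2].
by rewrite -fg// -fgx Hd.
Qed.

Lemma has_deriv_local (D D' : set R) f x l :
  (exists2 dl : R, 0 < dl & forall z, D' z -> `|z - x| < dl -> D z) ->
  has_deriv D f x l -> has_deriv D' f x l.
Proof.
move=> [d1 d10 fg] H e /H[dl dl0 Hd].
exists (Num.min d1 dl); first by rewrite lt_min d10.
move=> z Dz; rewrite lt_min => /andP[zx1 zx2].
by apply: Hd => //; exact: fg.
Qed.

Lemma has_deriv_cst (D : set R) k x : has_deriv D (fun=> k) x 0.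
Proof.
move=> e e0; exists 1 => // z _ _.
by rewrite subrr mulr0 subr0 ComplexField.Normc.normc0 mulr_ge0// ltW.
Qed.

Lemma has_derivD (D : set R) f g x l m :
  has_deriv D f x l -> has_deriv D g x m ->
  has_deriv D (fun z => f z + g z) x (l + m).
Proof.
move=> H1 H2 e e0; have e20 : 0 < e / 2 by rewrite divr_gt0.
have [d1 d10 K1] := H1 _ e20; have [d2 d20 K2] := H2 _ e20.
exists (Num.min d1 d2); first by rewrite lt_min d10.
move=> z Dz; rewrite lt_min => /andP[zx1 zx2].
have -> : f z + g z - (f x + g x) - (z - x)%:C * (l + m) =
  (f z - f x - (z - x)%:C * l) + (g z - g x - (z - x)%:C * m) by ring.
apply: le_trans (le_normcD _ _) _; rewrite (splitr e) mulrDl.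
by rewrite lerD ?K1 ?K2.
Qed.

Lemma has_derivM (D : set R) f g x l m :
  has_deriv D f x l -> has_deriv D g x m ->
  has_deriv D (fun z => f z * g z) x (l * g x + f x * m).
Proof.
move=> H1 H2 e e0.
pose M := normc (f x) + normc (g x) + normc l + 1.
have M0 : 0 < M by rewrite ltr_wpDl// !addr_ge0 ?normc_ge0.
pose e1 := e / 2 / M; have e10 : 0 < e1 by rewrite !divr_gt0.
have [d1 d10 K1] := H1 _ e10; have [d2 d20 K2] := H2 _ e10.
have [d3 d30 K3] := has_deriv_cont H2 e10.
have [d4 d40 K4] := has_deriv_cont H2 ltr01.
exists (Num.min (Num.min d1 d2) (Num.min d3 d4)).
  by rewrite !lt_min d10 d20 d30 d40.
move=> z Dz; rewrite !lt_min => /andP[/andP[zx1 zx2] /andP[zx3 zx4]].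
have -> : f z * g z - f x * g x - (z - x)%:C * (l * g x + f x * m) =
  (f z - f x - (z - x)%:C * l) * g x + (f z - f x - (z - x)%:C * l) * (g z - g x)
   + f x * (g z - g x - (z - x)%:C * m)
   + (z - x)%:C * l * (g z - g x) by ring.
have {}K1 := K1 z Dz zx1; have {}K2 := K2 z Dz zx2.
have {}K3 := K3 z Dz zx3; have {}K4 := K4 z Dz zx4.
have h0 := normr_ge0 (z - x).
apply: le_trans (le_normcD _ _) _.
apply: le_trans (_ : e1 * `|z - x| * (normc (g x) + 1 + normc (f x)) + `|z - x| * normc l * e1 <= _).
  apply: lerD; last first.
    rewrite !ComplexField.Normc.normcM normc_real ler_wpM2l//.
    by rewrite mulr_ge0 ?normc_ge0.
  apply: le_trans (le_normcD _ _) _; rewrite [leRHS]mulrDr; apply: lerD.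
    apply: le_trans (le_normcD _ _) _.
    by rewrite [leRHS]mulrDr !ComplexField.Normc.normcM lerD// ?ler_pM ?normc_ge0// ler_wpM2r ?normc_ge0.
  by rewrite !ComplexField.Normc.normcM mulrC ler_wpM2r ?normc_ge0.
have -> : e1 * `|z - x| * (normc (g x) + 1 + normc (f x)) + `|z - x| * normc l * e1
   = e1 * M * `|z - x| by rewrite /M; ring.
rewrite ler_wpM2r// /e1 divfK ?gt_eqF//.
by rewrite ler_pdivrMr// ler_pMr// ler1n.
Qed.

Lemma has_derivN (D : set R) f x l :
  has_deriv D f x l -> has_deriv D (fun z => - f z) x (- l).
Proof.
move=> H e /H[dl dl0 Hd]; exists dl => // z Dz zx.
have -> : - f z - - f x - (z - x)%:C * - l = - (f z - f x - (z - x)%:C * l) by ring.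
by rewrite normcN Hd.
Qed.

Lemma has_derivB (D : set R) f g x l m :
  has_deriv D f x l -> has_deriv D g x m ->
  has_deriv D (fun z => f z - g z) x (l - m).
Proof. by move=> H1 H2; apply: has_derivD => //; exact: has_derivN. Qed.

(** Affine changes of variable are the only compositions needed; their shape
    [p * z + q] is kept everywhere below, so that this applies by unification. *)
Lemma has_deriv_comp (D D' : set R) f x l (p q : R) :
  has_deriv D f (p * x + q) l ->
  (forall z, D' z -> D (p * z + q)) ->
  has_deriv D' (fun z => f (p * z + q)) x (p%:C * l).
Proof.
move=> H s e e0.
have p0 : 0 < `|p| + 1 by rewrite ltr_wpDl.
have [|dl dl0 Hd] := H (e / (`|p| + 1)); first by rewrite divr_gt0.
exists (dl / (`|p| + 1)); first by rewrite divr_gt0.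
move=> z Dz zx.
have E : p * z + q - (p * x + q) = p * (z - x) by ring.
have le1 : `|p * (z - x)| <= (`|p| + 1) * `|z - x|.
  by rewrite normrM ler_wpM2r// lerDl.
have lt1 : `|p * (z - x)| < dl.
  by apply: le_lt_trans le1 _; rewrite mulrC -ltr_pdivlMr.
have := Hd (p * z + q) (s _ Dz); rewrite E => /(_ lt1).
have -> : (z - x)%:C * (p%:C * l) = (p * (z - x))%:C * l by rewrite rmorphM; ring.
move=> /le_trans; apply.
rewrite -mulrA ler_wpM2l ?(ltW e0)//.
by rewrite ler_pdivrMl.
Qed.

Lemma has_deriv_real (f : R -> R) x (l : R) : is_derive x 1 f l ->
  has_deriv setT (fun z => (f z)%:C) x l%:C.
Proof.
move=> [Hd Hl]; have : h^-1 *: (f (h *: 1 + x) - f x) @[h --> 0^'] --> l.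
  by rewrite -Hl; exact: Hd.
move=> /cvgrPdist_lt H e /H /nbhs_ballP [dl /= dl0 Hdl].
exists dl => // z _ zx.
have [->|zx0] := eqVneq z x.
  by rewrite !subrr normr0 mulr0 mul0r subr0 ComplexField.Normc.normc0.
have := Hdl (z - x); rewrite /ball /= sub0r normrN => /(_ zx).
rewrite subr_eq0 => /(_ zx0).
rewrite /GRing.scale /= mulr1 subrK => /ltW Hn.
have -> : (f z)%:C - (f x)%:C - (z - x)%:C * l%:C
   = (- ((z - x) * (l - (z - x)^-1 * (f z - f x))))%:C.
  rewrite mulrBr mulrA mulfV ?subr_eq0// mul1r opprB.
  by rewrite !rmorphB /= rmorphM /= rmorphB.
by rewrite normc_real normrN normrM mulrC ler_wpM2r.
Qed.

(** Cousin's lemma as an induction principle: a property that passes from [u] to [v]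
    across every short interval around each tag [x] passes from [c] to [d],
    because the supremum of the points reached is itself a tag. *)
Lemma interval_induction (P : R -> Prop) c d : c <= d -> P c ->
  (forall x, c <= x <= d -> exists2 dl : R, 0 < dl &
     forall u v, c <= u -> u <= x -> x <= v -> v <= d -> u < v ->
       v - u < dl -> P u -> P v) ->
  P d.
Proof.
move=> cd Pc H.
pose A := [set x | c <= x <= d /\ P x].
have Ac : A c by split => //; rewrite lexx cd.
have hA : has_sup A.
  by split; [exists c | exists d => x -[/andP[]]].
pose s := sup A.
have cs : c <= s by apply: sup_upper_bound.
have sd : s <= d by apply: sup_le_ub; [exists c | move=> x -[/andP[]]].
have [|dl dl0 Hd] := H s; first by rewrite cs sd.
have Ps : P s.
  have [x [/andP[cx xd] Px] sx] := sup_adherent dl0 hA.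
  have xs : x <= s by apply: sup_upper_bound => //; split => //; rewrite cx.
  have [<-//|nxs] := eqVneq x s.
  by apply: (Hd x s) => //; [rewrite lt_neqAle nxs|rewrite ltrBlDl -ltrBlDr].
move: sd; rewrite le_eqVlt => /orP[/eqP <-//|sd].
pose y := Num.min d (s + dl / 2).
have sy : s < y by rewrite /y lt_min sd ltrDl divr_gt0.
have yd : y <= d by rewrite /y ge_min lexx.
have Py : P y.
  apply: (Hd s y) => //; first exact: ltW.
  have : y <= s + dl / 2 by rewrite /y ge_min lexx orbT.
  lra.
have : y <= s.
  apply: sup_upper_bound => //; split => //.
  by rewrite yd (le_trans cs)// ltW.
by rewrite leNgt sy.
Qed.
End derivatives.

(** * Absolute continuity and gluing in the Sobolev space *)

Section absolute_continuity.
Variable R : realType.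
Implicit Types (c d x : R) (f g : R -> R[i]).

(** Estimates at the tag [x] give one for [u, v] since [x] lies between [u] and [v]. *)
Lemma growth_step c d f x (M dl : R) :
  (forall z, c <= z <= d -> `|z - x| < dl -> normc (f z - f x) <= M * `|z - x|) ->
  forall u v, c <= u -> u <= x -> x <= v -> v <= d -> v - u < dl ->
  normc (f v - f u) <= M * (v - u).
Proof.
move=> step u v cu ux xv vd uv.
have Su : normc (f x - f u) <= M * (x - u).
  rewrite normcB_sym -[x - u]ger0_norm ?subr_ge0// distrC; apply: step.
    by rewrite cu (le_trans ux)// (le_trans xv).
  by rewrite distrC ger0_norm ?subr_ge0//; lra.
have Sv : normc (f v - f x) <= M * (v - x).
  rewrite -[v - x]ger0_norm ?subr_ge0//; apply: step.
    by rewrite vd (le_trans cu)// (le_trans ux).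
  by rewrite ger0_norm ?subr_ge0//; lra.
have := normc_triangle (f v) (f x) (f u); lra.
Qed.

Lemma mean_value_ineq c d f (l : R -> R[i]) M : c <= d ->
  (forall x, c <= x <= d -> has_deriv `[c, d] f x (l x)) ->
  (forall x, c <= x <= d -> normc (l x) <= M) ->
  normc (f d - f c) <= M * (d - c).
Proof.
move=> cd Hf HM; apply/ler_addgt0Pl => e e0.
have dc0 : 0 < d - c + 1 by rewrite ltr_wpDl// subr_ge0.
pose e1 := e / (d - c + 1).
have e10 : 0 < e1 by rewrite divr_gt0.
apply: (@le_trans _ _ ((M + e1) * (d - c))); last first.
  rewrite mulrDl addrC lerD2r /e1 mulrAC ler_pdivrMr// ler_pM2l//.
  by rewrite lerDl.
apply: (@interval_induction _ (fun x => normc (f x - f c) <= (M + e1) * (x - c)) c d) => //.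
  by rewrite !subrr mulr0 ComplexField.Normc.normc0.
move=> x cxd; have [dl dl0 Hd] := Hf x cxd e1 e10.
have step z : c <= z <= d -> `|z - x| < dl -> normc (f z - f x) <= (M + e1) * `|z - x|.
  move=> Dz zx; rewrite -(subrK ((z - x)%:C * l x) (f z - f x)).
  apply: le_trans (le_normcD _ _) _; rewrite mulrDl addrC lerD//.
    rewrite ComplexField.Normc.normcM normc_real mulrC ler_wpM2r//.
    exact: HM.
  by apply: Hd => //; rewrite in_itv.
exists dl => // u v cu ux xv vd uv vu Pu.
have := growth_step step cu ux xv vd vu.
have := normc_triangle (f v) (f u) (f c).
lra.
Qed.

Lemma cont_bounded c d f : c <= d ->
  (forall x, c <= x <= d -> cont_at `[c, d] f x) ->
  exists M : R, forall x, c <= x <= d -> normc (f x) <= M.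
Proof.
move=> cd Hf.
pose P x := exists M : R, forall z, c <= z <= x -> normc (f z) <= M.
suff : P d by [].
apply: (@interval_induction _ P c d cd) => [|x cxd].
  exists (normc (f c)) => z; rewrite -eq_le => /eqP <-.
  exact: lexx.
have [dl dl0 Hd] := Hf x cxd 1 ltr01.
exists dl => // u v cu ux xv vd uv vu [M HM].
exists (Num.max M (normc (f x) + 1)) => z /andP[cz zv].
rewrite le_max; have [zu|uz] := leP z u.
  by rewrite HM ?cz.
apply/orP; right; rewrite -[f z](subrK (f x)).
apply: le_trans (le_normcD _ _) _; rewrite addrC lerD2l.
apply: Hd; first by rewrite /= in_itv/= cz (le_trans zv).
by rewrite ltr_norml; apply/andP; split; lra.
Qed.

Lemma lipschitz_ac c d f M :
  (forall u v, c <= u -> u < v -> v <= d -> normc (f v - f u) <= M * (v - u)) ->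
  abs_continuous_on c d f.
Proof.
move=> H e e0; have M0 : 0 < `|M| + 1 by rewrite ltr_wpDl.
exists (e / (`|M| + 1)); first by rewrite divr_gt0.
move=> n u v uv _ S.
apply: (@le_lt_trans _ _ (\sum_(i < n) (`|M| + 1) * (v i - u i))).
  apply: ler_sum => i _; have [cu lt_uv vd] := uv i.
  apply: le_trans (H _ _ cu lt_uv vd) _.
  rewrite ler_wpM2r// ?subr_ge0 ?(ltW lt_uv)//.
  by rewrite (le_trans (ler_norm _))// lerDl.
by rewrite -mulr_sumr mulrC -ltr_pdivlMr.
Qed.

Lemma C1_ac c d f l : c <= d ->
  (forall x, c <= x <= d -> has_deriv `[c, d] f x (l x)) ->
  (forall x, c <= x <= d -> cont_at `[c, d] l x) ->
  abs_continuous_on c d f.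
Proof.
move=> cd Hf Hl; have [M HM] := cont_bounded cd Hl.
apply: (@lipschitz_ac _ _ _ M) => u v cu uv vd.
apply: (@mean_value_ineq _ _ _ l) => [|x /andP[ux xv]|x /andP[ux xv]].
- exact: ltW.
- apply: has_deriv_sub (Hf _ _).
    by move=> z /=; rewrite !in_itv/= => /andP[uz zv]; rewrite (le_trans cu)// (le_trans zv).
  by rewrite (le_trans cu)// (le_trans xv).
- by apply: HM; rewrite (le_trans cu)// (le_trans xv).
Qed.

Lemma ac_cont c d f x : abs_continuous_on c d f -> c <= x <= d -> cont_at `[c, d] f x.
Proof.
move=> H /andP[cx xd] e e0; have [dl dl0 Hd] := H e e0.
exists dl => // z; rewrite /= in_itv/= => /andP[cz zd] zx.
have T p q : trivIset [set: 'I_1] (fun=> `]p, q[%classic : set R).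
  by move=> i j _ _ _; rewrite !ord1.
have [zltx|xltz|->] := ltgtP z x.
- have /(_ _ (T _ _)) := Hd 1%N (fun=> z) (fun=> x).
  rewrite !big_ord1 normcB_sym => K; apply/ltW/K => //.
  by move: zx; rewrite ltr_norml; lra.
- have /(_ _ (T _ _)) := Hd 1%N (fun=> x) (fun=> z).
  rewrite !big_ord1 => K; apply/ltW/K => //.
  by move: zx; rewrite ltr_norml; lra.
- by rewrite subrr ComplexField.Normc.normc0 ltW.
Qed.

Lemma acD c d f g : abs_continuous_on c d f -> abs_continuous_on c d g ->
  abs_continuous_on c d (fun x => f x + g x).
Proof.
move=> H1 H2 e e0; have e20 : 0 < e / 2 by rewrite divr_gt0.
have [d1 d10 K1] := H1 _ e20; have [d2 d20 K2] := H2 _ e20.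
exists (Num.min d1 d2); first by rewrite lt_min d10.
move=> n u v uv T; rewrite lt_min => /andP[S1 S2].
apply: le_lt_trans (_ : \sum_(i < n) normc (f (v i) - f (u i)) +
    \sum_(i < n) normc (g (v i) - g (u i)) < e).
  rewrite -big_split; apply: ler_sum => i _ /=.
  by apply: le_trans (le_normcD _ _); rewrite opprD addrACA.
by rewrite (splitr e) ltrD ?K1 ?K2.
Qed.

Lemma acM c d f g : c <= d -> abs_continuous_on c d f -> abs_continuous_on c d g ->
  abs_continuous_on c d (fun x => f x * g x).
Proof.
move=> cd H1 H2 e e0.
have [M1 B1] := cont_bounded cd (fun x => @ac_cont c d f x H1).
have [M2 B2] := cont_bounded cd (fun x => @ac_cont c d g x H2).
pose M := Num.max 1 (Num.max M1 M2).
have M0 : 0 < M by rewrite lt_max ltr01.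
have {}B1 x : c <= x <= d -> normc (f x) <= M.
  by move=> /B1 K; rewrite !le_max K !orbT.
have {}B2 x : c <= x <= d -> normc (g x) <= M.
  by move=> /B2 K; rewrite !le_max K !orbT.
have e20 : 0 < e / 2 / M by rewrite !divr_gt0.
have [d1 d10 K1] := H1 _ e20; have [d2 d20 K2] := H2 _ e20.
exists (Num.min d1 d2); first by rewrite lt_min d10.
move=> n u v uv T; rewrite lt_min => /andP[S1 S2].
apply: le_lt_trans (_ : M * (\sum_(i < n) normc (f (v i) - f (u i))) +
    M * (\sum_(i < n) normc (g (v i) - g (u i))) < e).
  rewrite !mulr_sumr -big_split; apply: ler_sum => i _ /=.
  have [cu lt_uv vd] := uv i.
  have -> : f (v i) * g (v i) - f (u i) * g (u i) =
     g (v i) * (f (v i) - f (u i)) + f (u i) * (g (v i) - g (u i)) by ring.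
  apply: le_trans (le_normcD _ _) _.
  rewrite !ComplexField.Normc.normcM lerD// ler_wpM2r ?normc_ge0//.
    by apply: B2; rewrite vd andbT (le_trans cu)// ltW.
  by apply: B1; rewrite cu (le_trans _ vd)// ltW.
have := K1 _ _ _ uv T S1; have := K2 _ _ _ uv T S2.
rewrite !ltr_pdivlMr// => P1 P2.
lra.
Qed.

Lemma ac_sub c d c' d' f : c' <= c -> d <= d' ->
  abs_continuous_on c' d' f -> abs_continuous_on c d f.
Proof.
move=> cc dd H e /H[dl dl0 Hd]; exists dl => // n u v uv; apply: Hd => i.
by have [cu ? vd] := uv i; split => //; [exact: le_trans cu|exact: le_trans dd].
Qed.

Lemma trivIset_open_itv n (u v : 'I_n -> R) (O : set R) :
  (forall i, u i < v i) -> (forall i, `]u i, v i[%classic `<=` O) -> measurable O ->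
  trivIset [set: 'I_n] (fun i => `]u i, v i[%classic) ->
  ((\sum_(i < n) (v i - u i))%:E <= lebesgue_measure O)%E.
Proof.
move=> uv sO mO T.
have mi i : measurable (`]u i, v i[%classic : set R) by exact: measurable_itv.
have -> : (\sum_(i < n) (v i - u i))%:E =
    lebesgue_measure (\big[setU/set0]_(i < n) (`]u i, v i[%classic : set R)).
  rewrite measure_bigsetU_ord// -sumEFin; apply: eq_bigr => i _.
  by rewrite [RHS](lebesgue_measure_itv (Interval _ _)) /= lte_fin uv EFinB.
apply: le_measure; rewrite ?inE//; first exact: bigsetU_measurable.
by apply: (big_ind (fun X => X `<=` O)) => // X Y XO YO; rewrite subUset.
Qed.

Lemma negligible_open_cover (N : set R) (e : R) :
  lebesgue_measure.-negligible N -> 0 < e ->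
  exists U : set R, [/\ open U, N `<=` U & (lebesgue_measure U < e%:E)%E].
Proof.
move=> [A [mA A0 sA]] e0.
have {}A0 : lebesgue_measure A = 0%E by exact: A0.
have [|U [oU AU mU]] := lebesgue_regularity_outer mA _ e0.
  by rewrite [X in (X < _)%E](_ : _ = 0%E) ?ltry//; exact: A0.
exists U; split => //; first exact: subset_trans AU.
apply: le_lt_trans mU.
have {1}-> : U = (U `\` A) `|` A by rewrite setUC setDUK.
rewrite -[leRHS]adde0 -[X in (_ <= _ + X)%E]A0.
by apply: measureU2 => //; apply: measurableD => //; exact: open_measurable.
Qed.

(** Cover the exceptional null set by an open [U] of small measure and go from [c]
    to [d] by interval induction.  Steps around a tag outside [U] contribute at
    most [e] times their length; steps inside [U] are collected in a list of
    disjoint intervals, whose total contribution absolute continuity makes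
    small. *)
Lemma ac_deriv0_const c d f : c <= d -> abs_continuous_on c d f ->
  {ae lebesgue_measure, forall x, x \in `]c, d[ -> has_deriv `[c, d] f x 0} ->
  f d = f c.
Proof.
move=> cd acf aef.
apply: (@eq_of_normc_le _ _ _ (d - c + 1)) => e e0.
have [dl dl0 Hd] := acf e e0.
(* the end points carry no information on the derivative: add them to the null set *)
have : lebesgue_measure.-negligible
    ((~` [set x | x \in `]c, d[ -> has_deriv `[c, d] f x 0]) `|` ([set c] `|` [set d])).
  apply: negligibleU; first exact: aef.
  by apply: negligibleU; apply/negligibleP => //; exact: lebesgue_measure_set1.
move=> /negligible_open_cover/(_ dl0)[U [oU NU mU]].
have mmU : measurable U by exact: open_measurable.
have derU x : c <= x <= d -> ~ U x -> has_deriv `[c, d] f x 0.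
  move=> /andP[cx xd] nUx; have := contra_not (NU x) nUx.
  move=> /not_orP[/contrapT /= H /not_orP[xc xd']]; apply: H.
  rewrite in_itv/= !lt_neqAle cx xd !andbT; apply/andP; split; apply/eqP => //.
  by move=> E; apply: xc.
pose ok (s : seq (R * R)) x :=
  [/\ pairwise (fun p q : R * R => p.2 <= q.1) s &
     forall p, p \in s -> [/\ c <= p.1, p.1 < p.2, p.2 <= x & `]p.1, p.2[%classic `<=` U]].
pose P x := exists2 s, ok s x &
  normc (f x - f c) <= e * (x - c) + \sum_(p <- s) normc (f p.2 - f p.1).
have Pext u v s : c <= u -> u < v -> ok s u -> `]u, v[%classic `<=` U -> ok (rcons s (u, v)) v.
  move=> cu uv [sp sok] sU; split.
    rewrite pairwise_rcons sp andbT; apply/allP => p /sok[_ _ pu _] //.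
  move=> p; rewrite mem_rcons inE => /orP[/eqP ->//|/sok[? ? pu ?]]; split => //.
  by rewrite (le_trans pu)// ltW.
have : P d.
  apply: (@interval_induction _ P c d) => //.
    by exists [::]; [split|rewrite !subrr mulr0 big_nil addr0 ComplexField.Normc.normc0].
  move=> x /andP[cx xd].
  have [Ux|nUx] := pselect (U x).
    have /nbhs_ballP[dl1 /= dl10 Hdl1] : nbhs x U by exact: open_nbhs_nbhs.
    exists dl1 => // u v cu ux xv vd uv vu [s oks Hs].
    exists (rcons s (u, v)).
      apply: Pext => // z; rewrite /= in_itv/= => /andP[uz zv].
      apply: Hdl1; rewrite /ball/= ltr_norml; apply/andP; split; lra.
    rewrite big_rcons /= .
    have := normc_triangle (f v) (f u) (f c).
    have : 0 <= e * (v - u) by apply: mulr_ge0; rewrite ?subr_ge0 ltW.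
    lra.
  have [dl1 dl10 Hdl1] := derU x (introT andP (conj cx xd)) nUx e e0.
  exists dl1 => // u v cu ux xv vd uv vu [s [sp sok] Hs].
  exists s.
    split => // p /sok[? ? pu ?]; split => //.
    by rewrite (le_trans pu)// ltW.
  have step z : c <= z <= d -> `|z - x| < dl1 -> normc (f z - f x) <= e * `|z - x|.
    move=> Dz zx; have := Hdl1 z; rewrite mulr0 subr0; apply => //.
  have := growth_step step cu ux xv vd vu.
  have := normc_triangle (f v) (f u) (f c).
  lra.
move=> [s [sp sok] /le_trans]; apply.
rewrite [leRHS]mulrDr mulr1 lerD2l.
have inok (i : 'I_(size s)) := sok _ (mem_nth (c, c) (ltn_ord i)).
have Ts : trivIset [set: 'I_(size s)]
    (fun i => `](nth (c, c) s i).1, (nth (c, c) s i).2[%classic).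
  apply/trivIsetP => i j _ _.
  wlog ij : i j / (i < j)%N.
    move=> H; rewrite neq_lt => /orP[ij|ij]; [|rewrite setIC]; apply: H => //.
      by rewrite neq_lt ij.
    by rewrite neq_lt ij.
  move=> _; rewrite -subset0 => z /=; rewrite !in_itv/= => -[/andP[_ zi] /andP[zj _]].
  have := pairwiseP (c, c) sp i j; rewrite !inE !ltn_ord => /(_ isT isT ij).
  lra.
rewrite (big_nth (c, c)) big_mkord; apply/ltW/Hd => //.
- by move=> i; have [] := inok i.
- rewrite -lte_fin; apply: le_lt_trans mU; apply: trivIset_open_itv => // i.
    by have [] := inok i.
  by have [] := inok i.
Qed.

(** Degenerate intervals, which clipping at a point produces, contribute nothing. *)
Lemma ac_relaxed c d f (e dl : R) :
  (forall (n : nat) (u v : 'I_n -> R),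
    (forall i : 'I_n, [/\ c <= u i, u i < v i & v i <= d]) ->
    trivIset [set: 'I_n] (fun i : 'I_n => `]u i, v i[%classic) ->
    \sum_(i < n) (v i - u i) < dl ->
    \sum_(i < n) normc (f (v i) - f (u i)) < e) ->
  forall (n : nat) (u v : 'I_n -> R),
    (forall i : 'I_n, [/\ c <= u i, u i <= v i & v i <= d]) ->
    trivIset [set: 'I_n] (fun i : 'I_n => `]u i, v i[%classic) ->
    \sum_(i < n) (v i - u i) < dl ->
    \sum_(i < n) normc (f (v i) - f (u i)) < e.
Proof.
move=> H n u v uv T S.
pose A := [set i : 'I_n | u i < v i]%SET.
have sumA (F : 'I_n -> R) : (forall i, u i = v i -> F i = 0) ->
    \sum_(i < n) F i = \sum_(k < #|A|) F (enum_val k).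
  move=> F0; rewrite -big_enum_val /= (bigID (mem A)) /= [X in _ + X]big1 ?addr0 //.
  move=> i; rewrite inE -leNgt => vu; apply: F0.
  by apply/eqP; rewrite eq_le vu andbT; have [] := uv i.
rewrite sumA => [|i ->]; last by rewrite subrr ComplexField.Normc.normc0.
apply: H.
- move=> k; have [? _ ?] := uv (enum_val k); split => //.
  by have := enum_valP k; rewrite inE.
- by move=> i j _ _ ij; apply: enum_val_inj; apply: T.
- by rewrite -(sumA (fun i => v i - u i))// => i ->; rewrite subrr.
Qed.

Lemma clip_len (u v d : R) : u < v ->
  Num.min v d - Num.min u d <= v - u /\ Num.max v d - Num.max u d <= v - u.
Proof.
move=> uv; case: (ltP v d) => vd; case: (ltP u d) => ud; split; lra.
Qed.

Lemma clip_ord (c u v d e : R) : c <= d -> d <= e -> c <= u -> u < v -> v <= e ->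
  [/\ c <= Num.min u d, Num.min u d <= Num.min v d & Num.min v d <= d] /\
  [/\ d <= Num.max u d, Num.max u d <= Num.max v d & Num.max v d <= e].
Proof.
move=> cd de cu uv ve.
by case: (ltP v d) => vd; case: (ltP u d) => ud; split; split; lra.
Qed.

(** Clip every interval at [d] from both sides: the left and right parts are again
    disjoint families. *)
Lemma ac_glue c d e f : c <= d -> d <= e ->
  abs_continuous_on c d f -> abs_continuous_on d e f -> abs_continuous_on c e f.
Proof.
move=> cd de H1 H2 r r0; have r20 : 0 < r / 2 by rewrite divr_gt0.
have [d1 d10 K1] := H1 _ r20; have [d2 d20 K2] := H2 _ r20.
exists (Num.min d1 d2); first by rewrite lt_min d10.
move=> n u v uv T; rewrite lt_min => /andP[S1 S2].
have {}K1 := ac_relaxed K1; have {}K2 := ac_relaxed K2.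
pose lo x := Num.min x d; pose hi x := Num.max x d.
have loE x : lo x = if x < d then x else d by [].
have hiE x : hi x = if x < d then d else x by [].
have clip1 p q z : lo p < z < lo q -> p < z < q.
  by rewrite /lo gt_min lt_min => /andP[/orP[->|dz] /andP[-> zd]] //;
    have := lt_trans dz zd; rewrite ltxx.
have clip2 p q z : hi p < z < hi q -> p < z < q.
  by rewrite /hi gt_max lt_max => /andP[/andP[-> dz] /orP[->|zd]] //;
    have := lt_trans dz zd; rewrite ltxx.
apply: (@le_lt_trans _ _ (\sum_(i < n) normc (f (lo (v i)) - f (lo (u i))) +
    \sum_(i < n) normc (f (hi (v i)) - f (hi (u i))))).
  rewrite -big_split /=; apply: ler_sum => i _.
  have n0 := ComplexField.Normc.normc0 R.
  rewrite !loE !hiE; have [_ uvi _] := uv i.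
  case: ltP => vd; case: ltP => ud.
  - by rewrite subrr n0 addr0.
  - by move: (lt_le_trans uvi (ltW vd)); rewrite ltNge ud.
  - by rewrite addrC; exact: normc_triangle.
  - by rewrite subrr n0 add0r.
rewrite (splitr r); apply: ltrD; [apply: K1|apply: K2].
- move=> i; have [cu uvi ve] := uv i; exact: (clip_ord cd de cu uvi ve).1.
- move=> i j _ _ [z [/= zi zj]]; apply: T => //; exists z; move: zi zj.
  rewrite /= !in_itv/=.
  by move=> /clip1 -> /clip1 ->.
- apply: le_lt_trans S1; apply: ler_sum => i _; have [_ uvi _] := uv i; exact: (clip_len d uvi).1.
- move=> i; have [cu uvi ve] := uv i; exact: (clip_ord cd de cu uvi ve).2.
- move=> i j _ _ [z [/= zi zj]]; apply: T => //; exists z; move: zi zj.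
  rewrite /= !in_itv/=.
  by move=> /clip2 -> /clip2 ->.
- apply: le_lt_trans S2; apply: ler_sum => i _; have [_ uvi _] := uv i; exact: (clip_len d uvi).2.
Qed.

Lemma eq_ac c d f g : (forall x, c <= x <= d -> f x = g x) ->
  abs_continuous_on c d f -> abs_continuous_on c d g.
Proof.
move=> fg H e /H[dl dl0 Hd]; exists dl => // n u v uv T S.
under eq_bigr => i _.
  have [cu uvi vd] := uv i.
  rewrite -fg ?(le_trans cu (ltW uvi))// -fg ?cu ?(le_trans (ltW uvi))//.
  over.
exact: Hd.
Qed.

Lemma measurable_normc2 (D : set R) f :
  measurable_fun D (fun x => complex.Re (f x)) ->
  measurable_fun D (fun x => complex.Im (f x)) ->
  measurable_fun D (fun x => (normc (f x) ^+ 2)%:E).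
Proof.
move=> mr mi; apply/measurable_EFinP.
rewrite (_ : (fun x => _) = (fun x => complex.Re (f x) ^+ 2 + complex.Im (f x) ^+ 2)).
  by apply: measurable_funD; apply: measurable_funX.
apply/funext => x; case: (f x) => a b /=; rewrite /normc sqr_sqrtr//.
by rewrite addr_ge0// sqr_ge0.
Qed.

(** The derivative is pieced together from those on both sides; its value at [d]
    is arbitrary, since [d] is a null set. *)
Lemma W21_glue c d e f : c < d -> d < e -> W21 c d f -> W21 d e f -> W21 c e f.
Proof.
move=> cd de [ac1 [p1 [mr1 mi1 f1] ae1]] [ac2 [p2 [mr2 mi2 f2] ae2]].
split; first exact: (ac_glue (ltW cd) (ltW de)).
pose p x := if x < d then p1 x else if x == d then 0 else p2 x.
have pE1 x : x \in (`]c, d[%classic : set R) -> p x = p1 x.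
  by rewrite inE /= in_itv/= /p => /andP[_ ->].
have pE2 x : x \in (`]d, e[%classic : set R) -> p x = p2 x.
  by rewrite inE /= in_itv/= /p => /andP[dx _]; rewrite ltNge (ltW dx)/= gt_eqF.
have itvE : `]c, e[%classic = (`]c, d[ `|` [set d] `|` `]d, e[)%classic.
  rewrite eqEsubset; split => x /=; rewrite !in_itv/=.
    move=> /andP[cx xe]; have [xd|dx|->] := ltgtP x d; last by left; right.
      by left; left; rewrite cx.
    by right.
  move=> [[/andP[cx xd]|->]|/andP[dx xe]]; [|by rewrite cd|].
    by rewrite cx (lt_trans xd).
  by rewrite xe (lt_trans cd).
have meas (h : R[i] -> R) :
    measurable_fun `]c, d[%classic (fun x => h (p1 x)) ->
    measurable_fun `]d, e[%classic (fun x => h (p2 x)) ->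
    measurable_fun `]c, e[%classic (fun x => h (p x)).
  move=> h1 h2; rewrite itvE.
  have m1 : measurable (`]c, d[%classic `|` [set d]).
    by apply: measurableU => //; exact: measurable_itv.
  apply/measurable_funU => //; split; last first.
    by apply: eq_measurable_fun h2 => x /pE2 ->.
  apply/measurable_funU => //; split; last exact: measurable_fun_set1.
  by apply: eq_measurable_fun h1 => x /pE1 ->.
exists p.
  split; [exact: meas|exact: meas|].
  have mc1 : measurable_fun `]c, d[%classic (fun x => (normc (p x) ^+ 2)%:E).
    by apply: eq_measurable_fun (measurable_normc2 mr1 mi1) => x /pE1 ->.
  have mc2 : measurable_fun `]d, e[%classic (fun x => (normc (p x) ^+ 2)%:E).
    by apply: eq_measurable_fun (measurable_normc2 mr2 mi2) => x /pE2 ->.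
  have mm1 : measurable (`]c, d[%classic `|` [set d]).
    by apply: measurableU => //; exact: measurable_itv.
  have n0 x : (0 <= (normc (p x) ^+ 2)%:E)%E by rewrite lee_fin sqr_ge0.
  rewrite itvE ge0_integral_setU//; last 2 first.
  - apply/measurable_funU => //; split => //; apply/measurable_funU => //; split => //.
    exact: measurable_fun_set1.
  - apply/disj_setPS => x /=; rewrite !in_itv/=.
    by move=> [[/andP[_ xd]|->] /andP[dx _]]; move: dx; rewrite ?ltxx// ltNge ltW.
  rewrite ge0_integral_setU//; last 2 first.
  - apply/measurable_funU => //; split => //.
    exact: measurable_fun_set1.
  - by apply/disj_setPS => x /=; rewrite !in_itv/= => -[/andP[_ xd] xE]; move: xd; rewrite xE ltxx.
  rewrite [X in (_ + X + _)%E]integral_set1 adde0; apply: lte_add_pinfty.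
    by under eq_integral => x /pE1 -> do [].
  by under eq_integral => x /pE2 -> do [].
have aed : {ae lebesgue_measure, forall x : R, x != d}.
  exists [set d]; split => //; first exact: lebesgue_measure_set1.
  by move=> x /= /negP; rewrite negbK => /eqP.
move: ae1 ae2 aed; apply: (@filterS3 _ _ (ae_filter_ringOfSetsType _)) => x H1 H2 xd.
rewrite in_itv /= => /andP[cx xe]; apply/is_deriv_onP; rewrite /p.
case: ltgtP xd => // xd _.
- have /H1/is_deriv_onP : x \in `]c, d[ by rewrite in_itv/= cx.
  apply: has_deriv_local; exists (d - x); first by rewrite subr_gt0.
  move=> z; rewrite /= !in_itv/= => /andP[cz ze]; rewrite ltr_norml; lra.
- have /H2/is_deriv_onP : x \in `]d, e[ by rewrite in_itv/= xd.
  apply: has_deriv_local; exists (x - d); first by rewrite subr_gt0.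
  move=> z; rewrite /= !in_itv/= => /andP[cz ze]; rewrite ltr_norml; lra.
Qed.
End absolute_continuity.

(** * Antiderivatives and integrals of complex-valued functions *)

Section antiderivatives.
Variable R : realType.
Implicit Types (c d x : R) (f g F G : R -> R[i]).

Lemma ler_ReIm (z : R[i]) : `|complex.Re z| <= normc z /\ `|complex.Im z| <= normc z.
Proof.
case: z => a b; rewrite /normc /=.
by split; rewrite -sqrtr_sqr ler_wsqrtr ?lerDl ?lerDr ?sqr_ge0.
Qed.

Lemma cont_Re F x : cont_at setT F x ->
  {for x, continuous (fun z => complex.Re (F z))} /\
  {for x, continuous (fun z => complex.Im (F z))}.
Proof.
move=> H; split; apply/cvgrPdist_lt => e e0.
- have [|dl dl0 Hd] := H (e / 2); first by rewrite divr_gt0.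
  apply/nbhs_ballP; exists dl => //= z; rewrite /ball /= distrC => zx.
  apply: (@le_lt_trans _ _ (e / 2)); last by rewrite ltr_pdivrMr// ltr_pMr// ltr1n.
  apply: le_trans (Hd z I zx); rewrite distrC.
  rewrite (_ : _ - _ = complex.Re (F z - F x)); first by have [] := ler_ReIm (F z - F x).
  by case: (F z) (F x) => ? ? [].
- have [|dl dl0 Hd] := H (e / 2); first by rewrite divr_gt0.
  apply/nbhs_ballP; exists dl => //= z; rewrite /ball /= distrC => zx.
  apply: (@le_lt_trans _ _ (e / 2)); last by rewrite ltr_pdivrMr// ltr_pMr// ltr1n.
  apply: le_trans (Hd z I zx); rewrite distrC.
  rewrite (_ : _ - _ = complex.Im (F z - F x)); first by have [] := ler_ReIm (F z - F x).
  by case: (F z) (F x) => ? ? [].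
Qed.

Lemma cont_atD F G x : cont_at setT F x -> cont_at setT G x ->
  cont_at setT (fun z => F z + G z) x.
Proof.
move=> H1 H2 e e0; have e20 : 0 < e / 2 by rewrite divr_gt0.
have [d1 d10 K1] := H1 _ e20; have [d2 d20 K2] := H2 _ e20.
exists (Num.min d1 d2); first by rewrite lt_min d10.
move=> z Dz; rewrite lt_min => /andP[zx1 zx2].
rewrite opprD addrACA; apply: le_trans (le_normcD _ _) _.
by rewrite (splitr e) lerD ?K1 ?K2.
Qed.

Lemma cont_atM F G x : cont_at setT F x -> cont_at setT G x ->
  cont_at setT (fun z => F z * G z) x.
Proof.
move=> H1 H2 e e0; pose M := normc (F x) + normc (G x) + 1.
have M0 : 0 < M by rewrite ltr_wpDl// !addr_ge0 ?normc_ge0.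
have e10 : 0 < e / M by rewrite divr_gt0.
have [d1 d10 K1] := H1 _ e10; have [d2 d20 K2] := H2 _ e10.
have [d3 d30 K3] := H1 _ ltr01.
exists (Num.min d3 (Num.min d1 d2)); first by rewrite !lt_min d10 d20 d30.
move=> z Dz; rewrite !lt_min => /and3P[/(K3 _ Dz) {}K3 /(K1 _ Dz) {}K1 /(K2 _ Dz) {}K2].
have -> : F z * G z - F x * G x =
  F x * (G z - G x) + (F z - F x) * G x + (F z - F x) * (G z - G x) by ring.
apply: le_trans (le_normcD _ _) _.
have -> : e = e / M * normc (F x) + e / M * normc (G x) + e / M.
  by rewrite -mulrDr -[X in _ + X]mulr1 -mulrDr divfK ?gt_eqF.
apply: lerD.
  apply: le_trans (le_normcD _ _) _; rewrite !ComplexField.Normc.normcM; apply: lerD.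
    by rewrite mulrC ler_wpM2r ?normc_ge0.
  by rewrite ler_wpM2r ?normc_ge0.
rewrite ComplexField.Normc.normcM -[leRHS]mul1r.
by rewrite ler_pM ?normc_ge0.
Qed.

Lemma cont_atN F x : cont_at setT F x -> cont_at setT (fun z => - F z) x.
Proof.
by move=> H e /H[dl dl0 Hd]; exists dl => // z Dz zx; rewrite -opprD normcN Hd.
Qed.

Lemma cont_at_comp F (h : R -> R) x : cont_at setT F (h x) -> {for x, continuous h} ->
  cont_at setT (fun z => F (h z)) x.
Proof.
move=> H1 /cvgrPdist_lt H2 e /H1[d d0 Hd].
have /nbhs_ballP[dl /= dl0 Hdl] := H2 _ d0.
exists dl => // z _ zx; apply: Hd => //; rewrite distrC; apply: Hdl.
by rewrite /ball /= distrC.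
Qed.

Lemma cont_at_sub (D : set R) F x : cont_at setT F x -> cont_at D F x.
Proof. by move=> H e /H[dl dl0 Hd]; exists dl => // z _; exact: Hd. Qed.

Lemma deriv0_const c d f : c <= d ->
  (forall x, c <= x <= d -> has_deriv `[c, d] f x 0) -> f d = f c.
Proof.
move=> cd Hf; apply: (@eq_of_normc_le _ _ _ 1) => e e0.
apply: (@le_trans _ _ (0 * (d - c))); last by rewrite mul0r mulr1 ltW.
apply: (mean_value_ineq cd Hf) => x _.
by rewrite ComplexField.Normc.normc0.
Qed.

Definition antider_from (N : R) F x : R[i] :=
  (\int[lebesgue_measure]_(t in `[- N, x]) complex.Re (F t)) +i*
  (\int[lebesgue_measure]_(t in `[- N, x]) complex.Im (F t)).

Lemma antider_real (N : R) (f : R -> R) x : continuous f -> - N < x ->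
  is_derive x 1 (fun x : R => \int[lebesgue_measure]_(t in `[- N, x]) f t) (f x).
Proof.
move=> cf x1.
have [||H1 H2] := @continuous_FTC1_closed _ f (- N) x (x + 1) _ _ x1 (cf x).
- by rewrite ltrDl.
- apply: continuous_compact_integrable; first exact: segment_compact.
  exact: continuous_subspaceT.
by rewrite -H2 derive1E; exact: DeriveDef.
Qed.

Lemma antider_from_deriv N F x : (forall x, cont_at setT F x) -> - N < x ->
  has_deriv setT (antider_from N F) x (F x).
Proof.
move=> cF x1.
have H1 := has_deriv_real (antider_real (fun x => (cont_Re (cF x)).1) x1).
have H2 := has_deriv_real (antider_real (fun x => (cont_Re (cF x)).2) x1).
have := has_derivD H1 (has_derivM (has_deriv_cst _ ('i%C : R[i]) x) H2).
rewrite mul0r add0r -complexE.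
by apply: has_deriv_ext => [|]; [exists 1 => // z _ _|]; rewrite /antider_from [RHS]complexE.
Qed.

(** The base point [- (`|x| + 1)] moves with [x] to stay to its left, which makes
    this one antiderivative on the whole line; it vanishes at [0]. *)
Definition antider F x := antider_from (`|x| + 1) F x - antider_from (`|x| + 1) F 0.

(** Antiderivatives from different base points differ by a constant, so near a given
    point a fixed base point may be used. *)
Lemma antiderE N F x : (forall x, cont_at setT F x) -> `|x| < N ->
  antider F x = antider_from N F x - antider_from N F 0.
Proof.
move=> cF xN; rewrite /antider; set M := `|x| + 1.
have xM : `|x| < M by rewrite ltrDl.
pose f z := antider_from M F z - antider_from N F z.
have df z : - `|x| <= z -> has_deriv setT f z 0.
  move=> xz; rewrite -(subrr (F z)); apply: has_derivB; apply: antider_from_deriv => //.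
    by apply: lt_le_trans xz; rewrite ltrN2.
  by apply: lt_le_trans xz; rewrite ltrN2.
have fc z : - `|x| <= z -> f z = f (- `|x|).
  move=> xz; apply: (deriv0_const xz) => y /andP[xy _].
  exact: has_deriv_sub (df y xy).
have E : f x = f 0.
  by rewrite !fc// ?oppr_le0 // lerNl ler_normr lexx orbT.
move: E; rewrite /f => E.
rewrite -(subrK (antider_from N F x) (antider_from M F x)) E; ring.
Qed.

Lemma antider_deriv F x : (forall x, cont_at setT F x) -> has_deriv setT (antider F) x (F x).
Proof.
move=> cF; pose N := `|x| + 1.
have : has_deriv setT (fun z => antider_from N F z - antider_from N F 0) x (F x).
  rewrite -[F x]subr0; apply: has_derivB; last exact: has_deriv_cst.
  apply: antider_from_deriv => //; rewrite /N ltrNl.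
  by apply: (@le_lt_trans _ _ `|x|); rewrite ?ltrDl// ler_normr lexx orbT.
apply: has_deriv_ext; last by rewrite (@antiderE N)// ltrDl.
exists 1 => // z _ zx; rewrite (@antiderE N)// /N -ltrBlDl.
by apply: le_lt_trans zx; rewrite lerB_dist.
Qed.

Definition cint c d F := antider F d - antider F c.

Lemma cint_FTC c d F G : c <= d -> (forall x, cont_at setT F x) ->
  (forall x, c <= x <= d -> has_deriv `[c, d] G x (F x)) -> cint c d F = G d - G c.
Proof.
move=> cd cF dG.
have E : antider F d - G d = antider F c - G c.
  apply: (@deriv0_const c d (fun x => antider F x - G x)) => // x /andP[cx xd].
  rewrite -(subrr (F x)); apply: has_derivB; last by apply: dG; rewrite cx.
  exact: has_deriv_sub (@antider_deriv _ _ cF).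
by rewrite /cint -(subrK (G d) (antider F d)) E; ring.
Qed.

Lemma W21_C1 c d f l : c < d ->
  (forall x, c <= x <= d -> has_deriv `[c, d] f x (l x)) ->
  (forall x, cont_at setT l x) -> W21 c d f.
Proof.
move=> cd Hf Hl; split.
  by apply: (C1_ac (ltW cd) Hf) => x _; exact: cont_at_sub.
have mRe : measurable_fun setT (fun x => complex.Re (l x)).
  by apply: continuous_measurable_fun => x; have [] := cont_Re (Hl x).
have mIm : measurable_fun setT (fun x => complex.Im (l x)).
  by apply: continuous_measurable_fun => x; have [] := cont_Re (Hl x).
exists l; last first.
  apply: aeW => x; rewrite in_itv/= => /andP[cx xd]; apply/is_deriv_onP; apply: Hf.
  by rewrite !ltW.
split; [exact: measurable_funTS|exact: measurable_funTS|].
have [|M HM] := @cont_bounded _ c d l (ltW cd).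
  by move=> x _; exact: cont_at_sub.
apply: (@le_lt_trans _ _ (\int[lebesgue_measure]_(x in `]c, d[%classic) (M ^+ 2)%:E)%E).
  apply: ge0_le_integral => //.
  - by move=> x _; rewrite lee_fin sqr_ge0.
  - by apply: measurable_normc2; exact: measurable_funTS.
  - move=> x; rewrite /= in_itv/= => /andP[cx xd]; rewrite lee_fin ler_sqr ?nnegrE ?normc_ge0//.
      by apply: HM; rewrite !ltW.
    by apply: le_trans (normc_ge0 (l x)) _; apply: HM; rewrite !ltW.
rewrite integral_cst; last exact: measurable_itv.
by rewrite [X in (_ * X)%E](lebesgue_measure_itv (Interval _ _)) /= lte_fin cd -EFinB -EFinM ltry.
Qed.

Lemma W21_eq c d f g : c < d -> (forall x, c <= x <= d -> f x = g x) -> W21 c d f -> W21 c d g.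
Proof.
move=> cd fg [acf [p L2 aep]]; split; first exact: eq_ac acf.
exists p => //; move: aep; apply: (@filterS _ _ (ae_filter_ringOfSetsType _)) => x H Dx.
move: (H Dx) => /is_deriv_onP K; apply/is_deriv_onP; move: K; apply: has_deriv_ext.
  by exists 1 => // z Dz _; apply: fg; rewrite /= in_itv /= in Dz.
by apply: fg; move: Dx; rewrite in_itv/= => /andP[? ?]; rewrite !ltW.
Qed.
End antiderivatives.

(** * Solutions of y'' + lam y = 0 *)

Section trigonometric_pairs.
Variable R : realType.
Implicit Types (c d x : R) (f g F G : R -> R[i]).

Lemma has_deriv_eq (D : set R) f x l l' : has_deriv D f x l -> l = l' -> has_deriv D f x l'.
Proof. by move=> H <-. Qed.

Lemma has_deriv_affine (D : set R) f (l : R -> R[i]) (p q x : R) :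
  (forall x, has_deriv setT f x (l x)) ->
  has_deriv D (fun z => f (p * z + q)) x (p%:C * l (p * x + q)).
Proof. by move=> H; apply: has_deriv_comp (H _) _. Qed.

(** [S x = sin (r x) / r] and [C x = cos (r x)] with [r ^+ 2 = lam], where [S x = x] if
    [lam = 0].  Working from these relations alone treats all [lam] alike. *)
Definition trig_pair (lam : R[i]) (S C : R -> R[i]) : Prop :=
  [/\ S 0 = 0, C 0 = 1, forall x, has_deriv setT S x (C x) &
      forall x, has_deriv setT C x (- lam * S x)].

Lemma cexp_exists (mu : R[i]) : exists2 E : R -> R[i], E 0 = 1 &
  forall x, has_deriv setT E x (mu * E x).
Proof.
case: mu => a b.
exists (fun x => (expR (a * x + 0))%:C * ((cos (b * x + 0))%:C + 'i%C * (sin (b * x + 0))%:C)).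
  by rewrite !mulr0 !addr0 expR0 cos0 sin0 rmorph0 mulr0 addr0 mulr1.
move=> x; have ii : 'i%C * 'i%C = -1 :> R[i] by rewrite -expr2 sqr_i.
have He p : has_deriv setT (fun z : R => (expR (p * z + 0))%:C) x (p%:C * (expR (p * x + 0))%:C).
  by apply: (@has_deriv_affine _ (fun z => (expR z)%:C) (fun z => (expR z)%:C)) => z;
    exact: has_deriv_real.
have Hc p : has_deriv setT (fun z : R => (cos (p * z + 0))%:C) x (p%:C * (- sin (p * x + 0))%:C).
  by apply: (@has_deriv_affine _ (fun z => (cos z)%:C) (fun z => (- sin z)%:C)) => z;
    exact: has_deriv_real.
have Hs p : has_deriv setT (fun z : R => (sin (p * z + 0))%:C) x (p%:C * (cos (p * x + 0))%:C).
  by apply: (@has_deriv_affine _ (fun z => (sin z)%:C) (fun z => (cos z)%:C)) => z;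
    exact: has_deriv_real.
apply: has_deriv_eq (has_derivM (He a) (has_derivD (Hc b) (has_derivM (has_deriv_cst _ _ _) (Hs b)))) _.
rewrite [a +i* b]complexE rmorphN /=.
set e := (expR _)%:C; set s := (sin _)%:C; set k := (cos _)%:C.
have -> : (a%:C + 'i%C * b%:C) * (e * (k + 'i%C * s)) =
  a%:C * e * (k + 'i%C * s) + e * ('i%C * b%:C * k + ('i%C * 'i%C) * b%:C * s) by ring.
rewrite ii; ring.
Qed.

Lemma trig_pair_exists (lam : R[i]) : exists S C, trig_pair lam S C.
Proof.
have [->|lam0] := eqVneq lam 0.
  exists (fun x => x%:C), (fun=> 1); split => // x.
    apply: has_deriv_eq (@has_deriv_real _ id x 1 _) _ => //.
  by rewrite oppr0 mul0r; exact: has_deriv_cst.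
pose mu := sqrtC (- lam).
have mu2 : mu ^+ 2 = - lam by rewrite sqrtCK.
have mu0 : mu != 0 by apply: contra_neq lam0 => E; rewrite -[lam]opprK -mu2 E expr0n oppr0.
have [E E0 HE] := cexp_exists mu; have [F F0 HF] := cexp_exists (- mu).
exists (fun x => (2 * mu)^-1 * (E x - F x)), (fun x => 2^-1 * (E x + F x)).
have t0 : (2 : R[i]) != 0 by rewrite pnatr_eq0.
split.
- by rewrite E0 F0 subrr mulr0.
- by rewrite E0 F0 -[1 + 1]/(2%:R) mulVf.
- move=> x; apply: has_deriv_eq (has_derivM (has_deriv_cst _ _ _) (has_derivB (HE x) (HF x))) _.
  by field; rewrite ?mu0 ?t0.
- move=> x; apply: has_deriv_eq (has_derivM (has_deriv_cst _ _ _) (has_derivD (HE x) (HF x))) _.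
  by rewrite -mu2; field; rewrite ?mu0 ?t0.
Qed.

Lemma deriv0_const_global f (x y : R) : (forall x, has_deriv setT f x 0) -> f x = f y.
Proof.
move=> H; wlog xy : x y / x <= y.
  by move=> W; have [|/ltW] := leP x y; [exact: W|move/W].
by apply/esym/(@deriv0_const _ x y f xy) => z _; exact: has_deriv_sub (H z).
Qed.

Section trig.
Variables (lam : R[i]) (S C : R -> R[i]).
Hypothesis SC : trig_pair lam S C.
Let S0 : S 0 = 0. Proof. by case: SC. Qed.
Let C0 : C 0 = 1. Proof. by case: SC. Qed.

Lemma trig_dS x : has_deriv setT S x (C x). Proof. by case: SC. Qed.
Lemma trig_dC x : has_deriv setT C x (- lam * S x). Proof. by case: SC. Qed.

Lemma trig_sqr x : C x * C x + lam * S x * S x = 1.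
Proof.
have -> : 1 = C 0 * C 0 + lam * S 0 * S 0 by rewrite S0 C0; ring.
apply: (@deriv0_const_global (fun x => C x * C x + lam * S x * S x)) => z.
have dS := trig_dS z; have dC := trig_dC z.
apply: has_deriv_eq (has_derivD (has_derivM dC dC)
  (has_derivM (has_derivM (has_deriv_cst _ _ _) dS) dS)) _.
ring.
Qed.

(** The right-hand side with [x + y] fixed has derivative zero in [x]. *)
Lemma trig_addS x y : S (x + y) = S x * C y + C x * S y.
Proof.
pose f t := S t * C (- 1 * t + (x + y)) + C t * S (- 1 * t + (x + y)).
have -> : S (x + y) = f 0 by rewrite /f S0 C0 mulr0 add0r; ring.
have -> : S x * C y + C x * S y = f x by rewrite /f (_ : -1 * x + (x + y) = y)//; ring.
apply: deriv0_const_global => z; rewrite /f.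
have dS := @has_deriv_affine setT _ _ (-1) (x + y) z trig_dS.
have dC := @has_deriv_affine setT _ _ (-1) (x + y) z trig_dC.
apply: has_deriv_eq (has_derivD (has_derivM (trig_dS z) dC) (has_derivM (trig_dC z) dS)) _.
rewrite rmorphN rmorph1; ring.
Qed.

Lemma trig_addC x y : C (x + y) = C x * C y - lam * S x * S y.
Proof.
pose f t := C t * C (- 1 * t + (x + y)) - lam * S t * S (- 1 * t + (x + y)).
have -> : C (x + y) = f 0 by rewrite /f S0 C0 mulr0 add0r; ring.
have -> : C x * C y - lam * S x * S y = f x by rewrite /f (_ : -1 * x + (x + y) = y)//; ring.
apply: deriv0_const_global => z; rewrite /f.
have dS := @has_deriv_affine setT _ _ (-1) (x + y) z trig_dS.
have dC := @has_deriv_affine setT _ _ (-1) (x + y) z trig_dC.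
apply: has_deriv_eq (has_derivB (has_derivM (trig_dC z) dC)
  (has_derivM (has_derivM (has_deriv_cst _ _ _) (trig_dS z)) dS)) _.
rewrite rmorphN rmorph1; ring.
Qed.

Lemma trig_opp x : S (- x) = - S x /\ C (- x) = C x.
Proof.
have H1 : S x * C (- x) + C x * S (- x) = 0 by rewrite -trig_addS subrr S0.
have H2 : C x * C (- x) - lam * S x * S (- x) = 1 by rewrite -trig_addC subrr C0.
have H3 := trig_sqr x.
split.
- rewrite -[S (- x)]mulr1 -H3.
  have -> : S (- x) * (C x * C x + lam * S x * S x) = C x * (S x * C (- x) + C x * S (- x))
     - S x * (C x * C (- x) - lam * S x * S (- x)) by ring.
  by rewrite H1 H2; ring.
- rewrite -[C (- x)]mulr1 -H3.
  have -> : C (- x) * (C x * C x + lam * S x * S x) = lam * S x * (S x * C (- x) + C x * S (- x))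
     + C x * (C x * C (- x) - lam * S x * S (- x)) by ring.
  by rewrite H1 H2; ring.
Qed.

Lemma trig_subS x y : S (x - y) = S x * C y - C x * S y.
Proof. by rewrite trig_addS !(trig_opp y).1 (trig_opp y).2; ring. Qed.

Lemma trig_subC x y : C (x - y) = C x * C y + lam * S x * S y.
Proof. by rewrite trig_addC !(trig_opp y).1 (trig_opp y).2; ring. Qed.

Lemma trig_contS x : cont_at setT S x. Proof. exact: has_deriv_cont (trig_dS x). Qed.
Lemma trig_contC x : cont_at setT C x. Proof. exact: has_deriv_cont (trig_dC x). Qed.

(** The coordinates [C Z1 + lam S Z0] and [S Z1 - C Z0] of the solution in the basis
    [S, C] are absolutely continuous with derivative zero almost everywhere. *)
Lemma homogeneous_zero (d e : R) (Z0 Z1 : R -> R[i]) : d <= e ->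
  (forall x, 0 <= x <= e -> has_deriv `[0, e] Z0 x (Z1 x)) ->
  abs_continuous_on 0 e Z1 ->
  {ae lebesgue_measure, forall x, x \in `]0, d[ -> has_deriv `[0, e] Z1 x (- lam * Z0 x)} ->
  Z0 0 = 0 -> Z1 0 = 0 -> forall x, 0 <= x <= d -> Z0 x = 0 /\ Z1 x = 0.
Proof.
move=> de dZ0 acZ1 dZ1 Z00 Z10 x /andP[x0 xd].
have xe := le_trans xd de.
have acZ0 : abs_continuous_on 0 e Z0.
  apply: (C1_ac _ dZ0) => [|z ze]; first exact: le_trans xe.
  exact: ac_cont.
have sub0 : `[0, x]%classic `<=` (`[0, e]%classic : set R).
  by move=> z; rewrite /= !in_itv/= => /andP[-> zx]; rewrite (le_trans zx).
have acS : abs_continuous_on 0 x S.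
  apply: (C1_ac x0) => z _; [exact: has_deriv_sub (trig_dS z)|].
  exact/cont_at_sub/trig_contC.
have acC : abs_continuous_on 0 x C.
  apply: (C1_ac x0) => z _; [exact: has_deriv_sub (trig_dC z)|].
  apply/cont_at_sub/cont_atM; last exact: trig_contS.
  exact: has_deriv_cont (has_deriv_cst _ _ _).
have acK k : abs_continuous_on 0 x (fun=> k).
  apply: (@lipschitz_ac _ _ _ _ 0) => u v _ _ _.
  by rewrite subrr ComplexField.Normc.normc0 mul0r.
have {}acZ0 := ac_sub (lexx 0) xe acZ0; have {}acZ1 := ac_sub (lexx 0) xe acZ1.
have fil := ae_filter_ringOfSetsType (@lebesgue_measure R).
have dom z : z \in `]0, x[ -> (z \in `]0, d[) * (0 <= z <= e).
  rewrite !in_itv/= => /andP[z0 zx]; rewrite z0 (lt_le_trans zx)// (ltW z0).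
  by rewrite (le_trans (ltW zx)).
have W : C x * Z1 x + lam * (S x * Z0 x) = 0.
  have E0 : C 0 * Z1 0 + lam * (S 0 * Z0 0) = 0 by rewrite Z00 Z10; ring.
  rewrite -E0; apply: (@ac_deriv0_const _ 0 x (fun x => C x * Z1 x + lam * (S x * Z0 x))) => //.
    by apply: acD; [exact: acM|apply: acM => //; exact: acM].
  move: dZ1; apply: (@filterS _ _ fil) => z H /dom[/H{}H /dZ0 H0].
  have dS := has_deriv_sub (D' := `[0, x]%classic) (fun _ _ => I) (trig_dS z).
  have dC := has_deriv_sub (D' := `[0, x]%classic) (fun _ _ => I) (trig_dC z).
  apply: has_deriv_eq (has_derivD (has_derivM dC (has_deriv_sub sub0 H))
    (has_derivM (has_deriv_cst _ _ _) (has_derivM dS (has_deriv_sub sub0 H0)))) _.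
  ring.
have V : S x * Z1 x + (-1) * (C x * Z0 x) = 0.
  have E0 : S 0 * Z1 0 + (-1) * (C 0 * Z0 0) = 0 by rewrite Z00 Z10; ring.
  rewrite -E0; apply: (@ac_deriv0_const _ 0 x (fun x => S x * Z1 x + (-1) * (C x * Z0 x))) => //.
    by apply: acD; [exact: acM|apply: acM => //; exact: acM].
  move: dZ1; apply: (@filterS _ _ fil) => z H /dom[/H{}H /dZ0 H0].
  have dS := has_deriv_sub (D' := `[0, x]%classic) (fun _ _ => I) (trig_dS z).
  have dC := has_deriv_sub (D' := `[0, x]%classic) (fun _ _ => I) (trig_dC z).
  apply: has_deriv_eq (has_derivD (has_derivM dS (has_deriv_sub sub0 H))
    (has_derivM (has_deriv_cst _ _ _) (has_derivM dC (has_deriv_sub sub0 H0)))) _.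
  ring.
have H3 := trig_sqr x.
split.
- rewrite -[Z0 x]mulr1 -H3.
  have -> : Z0 x * (C x * C x + lam * S x * S x) =
    S x * (C x * Z1 x + lam * (S x * Z0 x)) - C x * (S x * Z1 x + (-1) * (C x * Z0 x)) by ring.
  by rewrite W V; ring.
- rewrite -[Z1 x]mulr1 -H3.
  have -> : Z1 x * (C x * C x + lam * S x * S x) =
    C x * (C x * Z1 x + lam * (S x * Z0 x)) + lam * S x * (S x * Z1 x + (-1) * (C x * Z0 x)) by ring.
  by rewrite W V; ring.
Qed.
End trig.
End trigonometric_pairs.

(** * The Green identity behind the construction *)

Section green.
Variable R : realType.
Implicit Types (c d x : R) (f g F G : R -> R[i]).

Lemma cint_FTC_global c d F G : (forall x, cont_at setT F x) ->
  (forall x, has_deriv setT G x (F x)) -> cint c d F = G d - G c.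
Proof.
move=> cF dG.
have E : antider F d - G d = antider F c - G c.
  apply: (@deriv0_const_global _ (fun x => antider F x - G x)) => x.
  by rewrite -(subrr (F x)); apply: has_derivB => //; exact: antider_deriv.
by rewrite /cint -(subrK (G d) (antider F d)) E; ring.
Qed.

Lemma cint_deriv F x : (forall x, cont_at setT F x) -> has_deriv setT (fun z => cint 0 z F) x (F x).
Proof.
move=> cF; rewrite -[F x]subr0; apply: has_derivB; first exact: antider_deriv.
exact: has_deriv_cst.
Qed.

Lemma cint_nil c F : cint c c F = 0. Proof. exact: subrr. Qed.

Lemma affine_continuous (p q : R) : continuous (fun z : R => p * z + q).
Proof. by move=> x; apply: cvgD; [exact: mulrl_continuous|exact: cvg_cst]. Qed.

Section kernel.
Variables (lam : R[i]) (S C : R -> R[i]).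
Hypothesis SC : trig_pair lam S C.
Let S0 : S 0 = 0. Proof. by case: SC. Qed.
Let C0 : C 0 = 1. Proof. by case: SC. Qed.

(* [U] is any solution of [U'' = - lam U], given with its derivative [V] and the
   addition formulas that all such solutions satisfy. *)
Variables (U V : R -> R[i]).
Hypothesis dU : forall x, has_deriv setT U x (V x).
Hypothesis dV : forall x, has_deriv setT V x (- lam * U x).
Hypothesis addU : forall x y, U (x + y) = U x * C y + V x * S y.
Hypothesis addV : forall x y, V (x + y) = V x * C y - lam * U x * S y.

(* [M2] is [m ^+ 2], and [HZ] is the equation [Z'' + M2 Z = c E] for
   [Z s = E l - E (l - s)]. *)
Variables (l b : R) (M2 c : R[i]) (E e e1 k h : R -> R[i]).
Hypothesis dE : forall x, has_deriv setT E x (e x).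
Hypothesis de : forall x, has_deriv setT e x (e1 x).
Hypothesis ce1 : forall x, cont_at setT e1 x.
Hypothesis dk : forall x, has_deriv setT k x (- h x).
Hypothesis dh : forall x, has_deriv setT h x (M2 * k x).
Hypotheses (E0 : E 0 = 0) (kl : k l = 0) (hl : h l = c) (el : e l = 0) (c0 : c != 0).
Hypothesis HZ : forall x, - e1 (l - x) + M2 * (E l - E (l - x)) = c * E x.

(** The convolution [int_0^s f t * U (2 (s - t) + 4 b) dt], with the kernel expanded
    by the addition formulas so that it is differentiated by the product rule. *)
Definition conv_U f s : R[i] :=
  U (2 * s + 4 * b) * cint 0 s (fun t => f t * C (2 * t + 0)) -
  V (2 * s + 4 * b) * cint 0 s (fun t => f t * S (2 * t + 0)).

Let cS2 x : cont_at setT (fun t => S (2 * t + 0)) x.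
Proof. exact: has_deriv_cont (has_deriv_affine setT 2 0 x (trig_dS SC)). Qed.
Let cC2 x : cont_at setT (fun t => C (2 * t + 0)) x.
Proof. exact: has_deriv_cont (has_deriv_affine setT 2 0 x (trig_dC SC)). Qed.

(** Convolution with a fixed kernel commutes with differentiation when [f 0 = 0];
    the boundary terms are matched by integrating [f1] by parts. *)
Lemma conv_U_deriv f f1 s : (forall x, has_deriv setT f x (f1 x)) ->
  (forall x, cont_at setT f1 x) -> f 0 = 0 ->
  has_deriv setT (conv_U f) s (conv_U f1 s).
Proof.
move=> df cf1 f0; have cf x := has_deriv_cont (df x).
have cfC x : cont_at setT (fun t => f t * C (2 * t + 0)) x by exact: cont_atM.
have cfS x : cont_at setT (fun t => f t * S (2 * t + 0)) x by exact: cont_atM.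
have PC := cint_deriv _ cfC; have PS := cint_deriv _ cfS.
have dC2 x := has_deriv_affine setT 2 0 x (trig_dC SC).
have dS2 x := has_deriv_affine setT 2 0 x (trig_dS SC).
apply: has_deriv_eq (has_derivB (has_derivM (has_deriv_affine setT 2 (4 * b) s dU) (PC s))
  (has_derivM (has_deriv_affine setT 2 (4 * b) s dV) (PS s))) _.
have E1 : cint 0 s (fun t => f1 t * C (2 * t + 0)) =
    f s * C (2 * s + 0) + 2%:C * lam * cint 0 s (fun t => f t * S (2 * t + 0)).
  rewrite (@cint_FTC_global _ _ _ (fun s =>
    f s * C (2 * s + 0) + 2%:C * lam * cint 0 s (fun t => f t * S (2 * t + 0)))).
  - by rewrite /= cint_nil f0; ring.
  - by move=> x; exact: cont_atM.
  - move=> x; apply: has_deriv_eq (has_derivD (has_derivM (df x) (dC2 x))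
      (has_derivM (has_deriv_cst _ _ _) (PS x))) _.
    rewrite /=; ring.
have E2 : cint 0 s (fun t => f1 t * S (2 * t + 0)) =
    f s * S (2 * s + 0) - 2%:C * cint 0 s (fun t => f t * C (2 * t + 0)).
  rewrite (@cint_FTC_global _ _ _ (fun s =>
    f s * S (2 * s + 0) - 2%:C * cint 0 s (fun t => f t * C (2 * t + 0)))).
  - by rewrite /= cint_nil f0; ring.
  - by move=> x; exact: cont_atM.
  - move=> x; apply: has_deriv_eq (has_derivB (has_derivM (df x) (dS2 x))
      (has_derivM (has_deriv_cst _ _ _) (PC x))) _.
    rewrite /=; ring.
rewrite /conv_U E1 E2; ring.
Qed.

Let Z x := E l - E ((-1) * x + l).
Let Z1 x := e ((-1) * x + l).
Let Z2 x := - e1 ((-1) * x + l).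

Let dZ x : has_deriv setT Z x (Z1 x).
Proof.
apply: has_deriv_eq (has_derivB (has_deriv_cst _ _ _) (has_deriv_affine setT (-1) l x dE)) _.
by rewrite rmorphN rmorph1 /Z1; ring.
Qed.

Let dZ1 x : has_deriv setT Z1 x (Z2 x).
Proof.
apply: has_deriv_eq (has_deriv_affine setT (-1) l x de) _.
by rewrite rmorphN rmorph1 /Z2; ring.
Qed.

Let cE x : cont_at setT E x. Proof. exact: has_deriv_cont (dE x). Qed.
Let ce x : cont_at setT e x. Proof. exact: has_deriv_cont (de x). Qed.
Let cZ x : cont_at setT Z x. Proof. exact: has_deriv_cont (dZ x). Qed.
Let cZ1 x : cont_at setT Z1 x. Proof. exact: has_deriv_cont (dZ1 x). Qed.
Let cZ2 x : cont_at setT Z2 x.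
Proof.
apply: cont_atN; apply: (@cont_at_comp _ e1 (fun z => -1 * z + l)) => //.
exact: affine_continuous.
Qed.

Let ZE x : Z2 x + M2 * Z x = c * E x.
Proof. by rewrite /Z2 /Z (_ : -1 * x + l = l - x) ?HZ//; ring. Qed.
Let Z_0 : Z 0 = 0. Proof. by rewrite /Z mulr0 add0r subrr. Qed.
Let Z1_0 : Z1 0 = 0. Proof. by rewrite /Z1 mulr0 add0r el. Qed.

(** With [conv_U_deriv], this makes [J = conv_U Z] satisfy the equation
    [J'' + M2 J = c * conv_U E], whose left side is the operator that annihilates [k]. *)
Lemma conv_U_ZE s : conv_U Z2 s + M2 * conv_U Z s = c * conv_U E s.
Proof.
have comb (T : R -> R[i]) : (forall x, cont_at setT T x) ->
  cint 0 s (fun t => Z2 t * T t) + M2 * cint 0 s (fun t => Z t * T t) =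
  c * cint 0 s (fun t => E t * T t).
  move=> cT.
  have c1 x : cont_at setT (fun t => Z2 t * T t) x by exact: cont_atM.
  have c2 x : cont_at setT (fun t => Z t * T t) x by exact: cont_atM.
  have c3 x : cont_at setT (fun t => E t * T t) x by exact: cont_atM.
  pose f z := cint 0 z (fun t => Z2 t * T t) + M2 * cint 0 z (fun t => Z t * T t) -
    c * cint 0 z (fun t => E t * T t).
  have fs0 : f s = f 0.
    apply: deriv0_const_global => z.
    apply: has_deriv_eq (has_derivB (has_derivD (cint_deriv _ c1)
      (has_derivM (has_deriv_cst _ _ _) (cint_deriv _ c2)))
      (has_derivM (has_deriv_cst _ _ _) (cint_deriv _ c3))) _.
    have -> : Z2 z * T z + (0 * cint 0 z (fun t => Z t * T t) + M2 * (Z z * T z)) -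
      (0 * cint 0 z (fun t => E t * T t) + c * (E z * T z)) =
      (Z2 z + M2 * Z z - c * E z) * T z by ring.
    by rewrite ZE subrr mul0r.
  apply/eqP; rewrite -subr_eq0; apply/eqP; rewrite -/(f s) fs0 /f !cint_nil; ring.
have HC := comb _ cC2; have HS := comb _ cS2.
rewrite /conv_U.
transitivity (U (2 * s + 4 * b) * (c * cint 0 s (fun t => E t * C (2 * t + 0))) -
  V (2 * s + 4 * b) * (c * cint 0 s (fun t => E t * S (2 * t + 0)))); last by ring.
rewrite -HC -HS; ring.
Qed.

(** Expanded form of [- int_0^s E t * S (s - b - 2 t) dt].  This is the solution of
    [w'' + lam w = e s * S (s + b)], [w 0 = w' 0 = 0], after one integration by
    parts. *)
Definition first_response s : R[i] :=
  - (S (1 * s + - b) * cint 0 s (fun t => E t * C (2 * t + 0)) -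
     C (1 * s + - b) * cint 0 s (fun t => E t * S (2 * t + 0))).

Let cEC x : cont_at setT (fun t => E t * C (2 * t + 0)) x. Proof. exact: cont_atM. Qed.
Let cES x : cont_at setT (fun t => E t * S (2 * t + 0)) x. Proof. exact: cont_atM. Qed.

(* The two integrals in [U w'] and [V w] combine, by the addition formulas, into
   the single convolution [conv_U E]. *)
Let U5w s : has_deriv setT (fun s => U (1 * s + 5 * b) * first_response s) s
   (E s * S (1 * s + b) * U (1 * s + 5 * b) - conv_U E s).
Proof.
have dS1 := has_deriv_affine setT 1 (- b) s (trig_dS SC).
have dC1 := has_deriv_affine setT 1 (- b) s (trig_dC SC).
apply: has_deriv_eq (has_derivM (has_deriv_affine setT 1 (5 * b) s dU) (has_derivN (has_derivB
   (has_derivM dS1 (cint_deriv s cEC)) (has_derivM dC1 (cint_deriv s cES))))) _.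
have H1 : U (2 * s + 4 * b) =
    U (1 * s + 5 * b) * C (1 * s + - b) + V (1 * s + 5 * b) * S (1 * s + - b).
  by rewrite -addU; congr U; ring.
have H2 : V (2 * s + 4 * b) =
    V (1 * s + 5 * b) * C (1 * s + - b) - lam * U (1 * s + 5 * b) * S (1 * s + - b).
  by rewrite -addV; congr V; ring.
have H3 : S (1 * s + b) = - (S (1 * s + - b) * C (2 * s + 0) - C (1 * s + - b) * S (2 * s + 0)).
  by rewrite -(trig_subS SC) -(trig_opp SC _).1; congr S; ring.
rewrite /conv_U /first_response H1 H2 H3 rmorph1; ring.
Qed.

Let U3 s : has_deriv setT (fun s => U (1 * s + 3 * b) * S (1 * s + b)) s (U (2 * s + 4 * b)).
Proof.
apply: has_deriv_eq (has_derivM (has_deriv_affine setT 1 (3 * b) s dU)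
  (has_deriv_affine setT 1 b s (trig_dS SC))) _.
have -> : 2 * s + 4 * b = (1 * s + 3 * b) + (1 * s + b) by ring.
rewrite [RHS]addU rmorph1; ring.
Qed.

Let SU s : S (1 * s + b) * U (1 * s + 5 * b) - S (1 * s + 2 * b) * U (1 * s + 4 * b) =
  - (U (3 * b) * S b).
Proof.
have H5 : U (1 * s + 5 * b) = U (3 * b) * C (1 * s + 2 * b) + V (3 * b) * S (1 * s + 2 * b).
  by rewrite -addU; congr U; ring.
have H4 : U (1 * s + 4 * b) = U (3 * b) * C (1 * s + b) + V (3 * b) * S (1 * s + b).
  by rewrite -addU; congr U; ring.
have H1 : S b = S (1 * s + 2 * b) * C (1 * s + b) - C (1 * s + 2 * b) * S (1 * s + b).
  by rewrite -(trig_subS SC); congr S; ring.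
rewrite H5 H4 H1; ring.
Qed.

Let cA p q x : cont_at setT (fun s => U (p * s + q)) x.
Proof. exact: has_deriv_cont (has_deriv_affine setT p q x dU). Qed.
Let cS p q x : cont_at setT (fun s => S (p * s + q)) x.
Proof. exact: has_deriv_cont (has_deriv_affine setT p q x (trig_dS SC)). Qed.

Lemma cint_reflect F : (forall x, cont_at setT F x) ->
  cint 0 l (fun s => F ((-1) * s + l)) = cint 0 l F.
Proof.
move=> cF; rewrite (@cint_FTC_global _ _ _ (fun s => - antider F ((-1) * s + l))).
- by rewrite /= mulr0 mulN1r addNr add0r /cint; ring.
- move=> x; apply: (@cont_at_comp _ F (fun z => -1 * z + l)) => //.
  exact: affine_continuous.
- move=> x; have dP := has_deriv_affine setT (-1) l x (fun y => antider_deriv y cF).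
  apply: has_deriv_eq (has_derivN dP) _.
  by rewrite rmorphN rmorph1; ring.
Qed.

Lemma conv_U_Z : conv_U Z l = cint 0 l (fun s => (E l - E s) * U (2 * s + 4 * b)).
Proof.
have cf x : cont_at setT (fun s => (E l - E s) * U (2 * s + 4 * b)) x.
  by apply: cont_atM => //; exact: has_deriv_cont (has_derivB (has_deriv_cst _ _ _) (dE x)).
rewrite -cint_reflect//.
pose G s := U (2 * l + 4 * b) * cint 0 s (fun t => Z t * C (2 * t + 0)) -
            V (2 * l + 4 * b) * cint 0 s (fun t => Z t * S (2 * t + 0)).
rewrite (@cint_FTC_global _ _ _ G).
- by rewrite /G !cint_nil /conv_U; ring.
- move=> x; apply: (@cont_at_comp _ _ (fun z => -1 * z + l) _ (cf _)).
  exact: affine_continuous.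
move=> x; apply: has_deriv_eq (has_derivB
  (has_derivM (has_deriv_cst _ _ _) (cint_deriv x (fun y => cont_atM (cZ y) (cC2 y))))
  (has_derivM (has_deriv_cst _ _ _) (cint_deriv x (fun y => cont_atM (cZ y) (cS2 y))))) _.
have H : U (2 * (-1 * x + l) + 4 * b) =
  U (2 * l + 4 * b) * C (2 * x + 0) - V (2 * l + 4 * b) * S (2 * x + 0).
  have -> : 2 * (-1 * x + l) + 4 * b = (2 * l + 4 * b) + - (2 * x + 0) by ring.
  by rewrite [LHS]addU (trig_opp SC _).1 (trig_opp SC _).2; ring.
rewrite H /Z; ring.
Qed.

(** [G] below is an antiderivative of [c] times the whole integrand: it collects the
    integrations by parts and, with [J = conv_U Z], the Green terms [k Z' - k' Z]
    and [k J' - k' J].  Then [G l = G 0], because [k l = 0], [h l = c], [Z l = E l],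
    [J l] is given by [conv_U_Z], and [Z], [Z'], [J], [J'] vanish at [0]. *)
Lemma green_identity :
  cint 0 l (fun s => U (1 * s + 3 * b) * e s * S (1 * s + b)) -
  cint 0 l (fun s => U (1 * s + 4 * b) * (k s * E s) * S (1 * s + 2 * b)) +
  cint 0 l (fun s => U (1 * s + 5 * b) * h s * first_response s) = 0.
Proof.
have ck x : cont_at setT k x := has_deriv_cont (dk x).
have ch x : cont_at setT h x := has_deriv_cont (dh x).
have dconst (z : R[i]) x : has_deriv setT (fun=> z) x 0 := has_deriv_cst _ z x.
have dJ s := conv_U_deriv s dZ cZ1 Z_0.
have dJ1 s := conv_U_deriv s dZ1 cZ2 Z1_0.
have cr x : cont_at setT (fun s => (E l - E s) * U (2 * s + 4 * b)) x.
  by apply: cont_atM => //; exact: has_deriv_cont (has_derivB (has_deriv_cst _ _ _) (dE x)).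
have cw x : cont_at setT first_response x.
  apply: cont_atN; apply: cont_atD; last apply: cont_atN; apply: cont_atM.
  - exact: cS.
  - exact: has_deriv_cont (cint_deriv x cEC).
  - exact: has_deriv_cont (has_deriv_affine setT 1 (- b) x (trig_dC SC)).
  - exact: has_deriv_cont (cint_deriv x cES).
pose f1 s := U (1 * s + 3 * b) * e s * S (1 * s + b).
pose f2 s := U (1 * s + 4 * b) * (k s * E s) * S (1 * s + 2 * b).
pose f3 s := U (1 * s + 5 * b) * h s * first_response s.
have c1 x : cont_at setT f1 x by apply: cont_atM => //; apply: cont_atM.
have c2 x : cont_at setT f2 x.
  by apply: cont_atM => //; apply: cont_atM => //; exact: cont_atM.
have c3 x : cont_at setT f3 x by apply: cont_atM => //; apply: cont_atM.
pose T s := antider f1 s - antider f2 s + antider f3 s.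
pose G s := c * ((E s - E l) * (U (1 * s + 3 * b) * S (1 * s + b)))
  + c * antider (fun s => (E l - E s) * U (2 * s + 4 * b)) s
  - c * (k s * (U (1 * s + 5 * b) * first_response s))
  - U (3 * b) * S b * (k s * Z1 s + h s * Z s)
  - (k s * conv_U Z1 s + h s * conv_U Z s).
have dG s : has_deriv setT (fun s => G s - c * T s) s 0.
  have D1 := has_derivM (dconst c s)
    (has_derivM (has_derivB (dE s) (dconst (E l) s)) (U3 s)).
  have D2 := has_derivM (dconst c s) (antider_deriv s cr).
  have D3 := has_derivM (dconst c s) (has_derivM (dk s) (U5w s)).
  have D4 := has_derivM (dconst (U (3 * b) * S b) s)
     (has_derivD (has_derivM (dk s) (dZ1 s)) (has_derivM (dh s) (dZ s))).
  have D5 := has_derivD (has_derivM (dk s) (dJ1 s)) (has_derivM (dh s) (dJ s)).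
  have D6 := has_derivM (dconst c s) (has_derivD
    (has_derivB (antider_deriv s c1) (antider_deriv s c2)) (antider_deriv s c3)).
  apply: has_deriv_eq (has_derivB (has_derivB (has_derivB (has_derivB
    (has_derivD D1 D2) D3) D4) D5) D6) _.
  have -> : Z2 s = c * E s - M2 * Z s by rewrite -ZE; ring.
  have -> : conv_U Z2 s = c * conv_U E s - M2 * conv_U Z s.
    by rewrite -conv_U_ZE; ring.
  have -> : U (3 * b) * S b =
      S (1 * s + 2 * b) * U (1 * s + 4 * b) - S (1 * s + b) * U (1 * s + 5 * b).
    by rewrite -[LHS]opprK -(SU s); ring.
  rewrite /f1 /f2 /f3; ring.
have GT : G l - G 0 = c * (cint 0 l f1 - cint 0 l f2 + cint 0 l f3).
  have K : G l - c * T l = G 0 - c * T 0 := deriv0_const_global l 0 dG.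
  by rewrite -[G l](subrK (c * T l)) K /T /cint; ring.
apply: (mulfI c0); rewrite mulr0 -GT /G.
have cu0 f : conv_U f 0 = 0 by rewrite /conv_U !cint_nil; ring.
have w0 : first_response 0 = 0 by rewrite /first_response !cint_nil; ring.
have Zl : Z l = E l by rewrite /Z mulN1r addNr E0 subr0.
rewrite conv_U_Z !cu0 w0 Zl kl hl Z1_0 Z_0 E0 /cint !mulr0 !add0r; ring.
Qed.
End kernel.
End green.

(** * Duhamel's formula and uniqueness for the delay equation *)

Section duhamel_principle.
Variable R : realType.
Implicit Types (c d x : R) (f g F G : R -> R[i]).

Lemma cint_eq0 c d F : c <= d -> (forall x, cont_at setT F x) ->
  (forall x, c <= x <= d -> F x = 0) -> cint c d F = 0.
Proof.
move=> cd cF F0; rewrite (@cint_FTC _ c d F (fun=> 0)) ?subrr// => x cxd.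
by rewrite F0//; exact: has_deriv_cst.
Qed.

Lemma eq_cint c d F G : c <= d -> (forall x, cont_at setT F x) -> (forall x, cont_at setT G x) ->
  (forall x, c <= x <= d -> F x = G x) -> cint c d F = cint c d G.
Proof.
move=> cd cF cG FG; rewrite (@cint_FTC _ c d F (antider G)) // => x cxd.
by rewrite FG//; exact: has_deriv_sub (antider_deriv _ cG).
Qed.

Lemma cint_add c d e F : cint c d F + cint d e F = cint c e F.
Proof. by rewrite /cint; ring. Qed.

Lemma cint_shift (l q : R) F G : 0 <= l ->
  (forall x, cont_at setT F x) -> (forall x, cont_at setT G x) ->
  (forall s, 0 <= s <= l -> F (1 * s + q) = G s) ->
  cint q (l + q) F = cint 0 l G.
Proof.
move=> l0 cF cG FG.
rewrite (@cint_FTC _ 0 l G (fun s => antider F (1 * s + q))) //.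
  by rewrite /= /cint mul1r mulr0 add0r.
move=> x x0l; rewrite -FG// -[X in has_deriv _ _ _ X]mul1r.
have := has_deriv_affine `[0, l]%classic 1 q x (fun y => antider_deriv y cF).
by rewrite rmorph1.
Qed.

(** An integrand supported in [q, l + q] is integrated in the shifted variable. *)
Lemma cint_support (l q p : R) F G : 0 <= q -> 0 <= l -> l + q <= p ->
  (forall x, cont_at setT F x) -> (forall x, cont_at setT G x) ->
  (forall x, 0 <= x <= q -> F x = 0) -> (forall x, l + q <= x <= p -> F x = 0) ->
  (forall s, 0 <= s <= l -> F (1 * s + q) = G s) ->
  cint 0 p F = cint 0 l G.
Proof.
move=> q0 l0 lqp cF cG F1 F2 FG.
rewrite -(cint_add 0 q) -(cint_add q (l + q)) (cint_eq0 q0 cF F1) (cint_eq0 lqp cF F2).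
by rewrite add0r addr0; exact: cint_shift.
Qed.

Section conv.
Variables (lam : R[i]) (S C : R -> R[i]).
Hypothesis SC : trig_pair lam S C.
Let S0 : S 0 = 0. Proof. by case: SC. Qed.
Let C0 : C 0 = 1. Proof. by case: SC. Qed.
Let cS := trig_contS SC.
Let cC := trig_contC SC.

(** [int_0^x S (x - t) * F t dt], with the kernel expanded. *)
Definition duhamel F x : R[i] :=
  S x * cint 0 x (fun t => C t * F t) - C x * cint 0 x (fun t => S t * F t).
Definition duhamel1 F x : R[i] :=
  C x * cint 0 x (fun t => C t * F t) + lam * S x * cint 0 x (fun t => S t * F t).

Lemma duhamel_deriv F x : (forall x, cont_at setT F x) ->
  has_deriv setT (duhamel F) x (duhamel1 F x).
Proof.
move=> cF.
have c1 y : cont_at setT (fun t => C t * F t) y by exact: cont_atM.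
have c2 y : cont_at setT (fun t => S t * F t) y by exact: cont_atM.
apply: has_deriv_eq (has_derivB (has_derivM (trig_dS SC x) (cint_deriv x c1))
  (has_derivM (trig_dC SC x) (cint_deriv x c2))) _.
rewrite /duhamel1; ring.
Qed.

Lemma duhamel1_deriv F x : (forall x, cont_at setT F x) ->
  has_deriv setT (duhamel1 F) x (F x - lam * duhamel F x).
Proof.
move=> cF.
have c1 y : cont_at setT (fun t => C t * F t) y by exact: cont_atM.
have c2 y : cont_at setT (fun t => S t * F t) y by exact: cont_atM.
apply: has_deriv_eq (has_derivD (has_derivM (trig_dC SC x) (cint_deriv x c1))
  (has_derivM (has_derivM (has_deriv_cst _ _ _) (trig_dS SC x)) (cint_deriv x c2))) _.
rewrite -[F x in RHS]mulr1 -(trig_sqr SC x) /duhamel; ring.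
Qed.

Lemma eq_duhamel F G x : 0 <= x -> (forall x, cont_at setT F x) -> (forall x, cont_at setT G x) ->
  (forall t, 0 <= t <= x -> F t = G t) ->
  duhamel F x = duhamel G x /\ duhamel1 F x = duhamel1 G x.
Proof.
move=> x0 cF cG FG; rewrite /duhamel /duhamel1.
have -> : cint 0 x (fun t => C t * F t) = cint 0 x (fun t => C t * G t).
  by apply: eq_cint => // [y|y|y /FG->//]; exact: cont_atM.
have -> // : cint 0 x (fun t => S t * F t) = cint 0 x (fun t => S t * G t).
by apply: eq_cint => // [y|y|y /FG->//]; exact: cont_atM.
Qed.

Lemma duhamel_eq0 F x : 0 <= x -> (forall x, cont_at setT F x) ->
  (forall t, 0 <= t <= x -> F t = 0) -> duhamel F x = 0 /\ duhamel1 F x = 0.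
Proof.
move=> x0 cF F0.
have [|-> ->] := @eq_duhamel F (fun=> 0) x x0 cF _ F0.
  by move=> y; exact: has_deriv_cont (has_deriv_cst _ _ _).
have z0 T : (forall y, cont_at setT T y) -> cint 0 x (fun t => T t * 0) = 0.
  move=> cT; apply: cint_eq0 => // [y|y _]; last by rewrite mulr0.
  by apply: cont_atM => //; exact: has_deriv_cont (has_deriv_cst _ _ _).
by rewrite /duhamel /duhamel1 !z0 // !mulr0 subrr addr0.
Qed.

Lemma duhamel_cont F x : (forall x, cont_at setT F x) -> cont_at setT (duhamel F) x.
Proof. by move=> cF; exact: has_deriv_cont (duhamel_deriv x cF). Qed.

(** Method of steps: if two solutions agree on [0, n a], the delayed term of their
    difference vanishes on [0, (n + 1) a], which leaves the homogeneous equation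
    there. *)
Lemma delay_solution_unique a q (Y Y' : 'I_2 -> R -> R[i]) : 0 < a ->
  delay_solution a q lam Y -> delay_solution a q lam Y' ->
  (forall j, Y j 0 = Y' j 0) ->
  (forall x, 0 < x < a -> q x = 0) ->
  forall j x, 0 <= x <= pi -> Y j x = Y' j x.
Proof.
move=> a0 [dY acY aeY] [dY' acY' aeY'] Y0 q0.
pose Z0 x := Y 0 x + (-1) * Y' 0 x; pose Z1 x := Y 1 x + (-1) * Y' 1 x.
have ZE x : Z0 x = 0 /\ Z1 x = 0 -> forall j, Y j x = Y' j x.
  move=> [A B] j; have : j = 0 \/ j = 1.
    by case: j => -[|[|//]] i; [left|right]; apply: val_inj.
  by move=> [->|->]; apply/eqP; rewrite -subr_eq0 -mulN1r; apply/eqP.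
suff step n : forall e, e <= pi -> e <= a * n%:R ->
    forall x, 0 <= x <= e -> Z0 x = 0 /\ Z1 x = 0.
  move=> j x x0pi; apply: ZE.
  have [n Hn] : exists n : nat, pi <= a * n%:R.
    exists (Num.truncn (pi / a)).+1; rewrite mulrC -ler_pdivrMr//.
    by rewrite ltW// truncnS_gt.
  exact: (step n pi).
have dZ0 x : 0 <= x <= pi -> has_deriv `[0, pi] Z0 x (Z1 x).
  move=> x0p.
  have /dY/is_deriv_onP H1 : x \in `[0, pi] by rewrite in_itv.
  have /dY'/is_deriv_onP H2 : x \in `[0, pi] by rewrite in_itv.
  apply: has_deriv_eq (has_derivD H1 (has_derivM (has_deriv_cst _ _ _) H2)) _.
  by rewrite /Z1; ring.
have acZ1 : abs_continuous_on 0 pi Z1.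
  apply: acD => //; apply: acM => //; first exact: pi_ge0.
  by apply: (@lipschitz_ac _ _ _ _ 0) => *; rewrite subrr ComplexField.Normc.normc0 mul0r.
have fil := ae_filter_ringOfSetsType (@lebesgue_measure R).
elim: n => [|n IH] e epi.
  rewrite mulr0 => e0 x /andP[x0 xe].
  have -> : x = 0 by apply/eqP; rewrite eq_le x0 (le_trans xe e0).
  by rewrite /Z0 /Z1 !Y0; split; ring.
move=> en.
apply: (@homogeneous_zero _ _ _ _ SC e pi Z0 Z1) => //; last 2 first.
- by rewrite /Z0 Y0; ring.
- by rewrite /Z1 Y0; ring.
move: aeY aeY'; apply: (@filterS2 _ _ fil) => x H1 H2 xe.
have x0p : x \in `]0, pi[.
  by move: xe; rewrite !in_itv/= => /andP[-> /lt_le_trans]; apply.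
have [y2 /is_deriv_onP D1 E1] := H1 x0p; have [y2' /is_deriv_onP D2 E2] := H2 x0p.
apply: has_deriv_eq (has_derivD D1 (has_derivM (has_deriv_cst _ _ _) D2)) _.
have qZ : q x * Z0 (x - a) = 0.
  move: xe; rewrite in_itv/= => /andP[x0 xe]; have [xa|ax] := ltP x a.
    by rewrite q0 ?mul0r// x0.
  have [|||-> _] := IH (x - a) _ _ (x - a).
  - by have := pi_gt0 R; lra.
  - move: en; rewrite -natr1 mulrDr mulr1; lra.
  - by rewrite lexx andbT subr_ge0.
  - by rewrite mulr0.
have -> : y2 = q x * Y 0 (x - a) - lam * Y 0 x by rewrite -E1; ring.
have -> : y2' = q x * Y' 0 (x - a) - lam * Y' 0 x by rewrite -E2; ring.
rewrite mul0r add0r.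
transitivity (q x * Z0 (x - a) - lam * Z0 x); first by rewrite /Z0; ring.
by rewrite qZ /Z0; ring.
Qed.

Lemma delay_solution_start a q (Y : 'I_2 -> R -> R[i]) d : 0 < a -> d <= pi ->
  delay_solution a q lam Y -> Y 0 0 = 0 -> Y 1 0 = 1 ->
  (forall x, 0 < x < d -> q x = 0) ->
  forall x, 0 <= x <= d -> Y 0 x = S x.
Proof.
move=> a0 dpi [dY acY aeY] Y00 Y10 q0.
pose Z0 x := Y 0 x + (-1) * S x; pose Z1 x := Y 1 x + (-1) * C x.
have fil := ae_filter_ringOfSetsType (@lebesgue_measure R).
suff H x : 0 <= x <= d -> Z0 x = 0 /\ Z1 x = 0.
  by move=> x /H[A _]; apply/eqP; rewrite -subr_eq0 -mulN1r; apply/eqP.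
apply: (@homogeneous_zero _ _ _ _ SC d pi Z0 Z1) => //.
- move=> {}x x0p; have /dY/is_deriv_onP H1 : x \in `[0, pi] by rewrite in_itv.
  have H2 := has_deriv_sub (D' := `[0, pi]%classic) (fun _ _ => I) (trig_dS SC x).
  apply: has_deriv_eq (has_derivD H1 (has_derivM (has_deriv_cst _ _ _) H2)) _.
  by rewrite /Z1; ring.
- apply: acD => //; apply: (C1_ac (pi_ge0 R)) => {}x _.
    apply: has_derivM; first exact: has_deriv_cst.
    exact: has_deriv_sub (trig_dC SC x).
  apply: cont_at_sub; apply: cont_atD; apply: cont_atM => //.
  + exact: has_deriv_cont (has_deriv_cst _ _ _).
  + exact: has_deriv_cont (has_deriv_cst _ _ _).
  + apply: cont_atM => //; exact: has_deriv_cont (has_deriv_cst _ _ _).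
- move: aeY; apply: (@filterS _ _ fil) => {}x H1 xd.
  have x0p : x \in `]0, pi[.
    by move: xd; rewrite !in_itv/= => /andP[-> /lt_le_trans]; apply.
  have [y2 /is_deriv_onP D1 E1] := H1 x0p.
  have H2 := has_deriv_sub (D' := `[0, pi]%classic) (fun _ _ => I) (trig_dC SC x).
  apply: has_deriv_eq (has_derivD D1 (has_derivM (has_deriv_cst _ _ _) H2)) _.
  have -> : y2 = q x * Y 0 (x - a) - lam * Y 0 x by rewrite -E1; ring.
  by rewrite q0 /Z0//; ring.
- by rewrite /Z0 Y00 S0; ring.
- by rewrite /Z1 Y10 C0; ring.
Qed.
End conv.
End duhamel_principle.

(** * Real-valued profiles *)

Section real_calculus. Variable R : realType.
Implicit Types (f g : R -> R) (x : R).

Definition rderiv f x (l : R) := has_deriv setT (fun z => (f z)%:C) x l%:C.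

Lemma rderiv_eq f x l l' : rderiv f x l -> l = l' -> rderiv f x l'.
Proof. by move=> H <-. Qed.

Lemma rderiv_cst k x : rderiv (fun=> k) x 0.
Proof. exact: has_deriv_cst. Qed.

Lemma rderivD f g x l m : rderiv f x l -> rderiv g x m -> rderiv (fun z => f z + g z) x (l + m).
Proof.
move=> H1 H2; rewrite /rderiv rmorphD.
rewrite (_ : (fun z => _) = (fun z => (f z)%:C + (g z)%:C)); first exact: has_derivD.
by apply/funext => z; rewrite rmorphD.
Qed.

Lemma rderivB f g x l m : rderiv f x l -> rderiv g x m -> rderiv (fun z => f z - g z) x (l - m).
Proof.
move=> H1 H2; rewrite /rderiv rmorphB.
rewrite (_ : (fun z => _) = (fun z => (f z)%:C - (g z)%:C)); first exact: has_derivB.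
by apply/funext => z; rewrite rmorphB.
Qed.

Lemma rderivM f g x l m : rderiv f x l -> rderiv g x m ->
  rderiv (fun z => f z * g z) x (l * g x + f x * m).
Proof.
move=> H1 H2; rewrite /rderiv rmorphD !rmorphM.
rewrite (_ : (fun z => _) = (fun z => (f z)%:C * (g z)%:C)); first exact: has_derivM.
by apply/funext => z; rewrite rmorphM.
Qed.

Lemma rderivZ k g x m : rderiv g x m -> rderiv (fun z => k * g z) x (k * m).
Proof. by move=> H; apply: rderiv_eq (rderivM (rderiv_cst k x) H) _; ring. Qed.

Lemma rderiv_comp f (f' : R -> R) (p q x : R) : (forall y, rderiv f y (f' y)) ->
  rderiv (fun z => f (p * z + q)) x (p * f' (p * x + q)).
Proof.
move=> H; rewrite /rderiv rmorphM.
exact: (@has_deriv_affine _ setT (fun z => (f z)%:C) (fun z => (f' z)%:C)).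
Qed.

Lemma rderiv_shift f (f' : R -> R) (q x : R) : (forall y, rderiv f y (f' y)) ->
  rderiv (fun z => f (z - q)) x (f' (x - q)).
Proof.
move=> H; have := rderiv_comp 1 (- q) x H.
rewrite !mul1r; congr (rderiv _ _ _); apply/funext => z; by rewrite mul1r.
Qed.

Lemma rderiv_sin x : rderiv (@sin R) x (cos x). Proof. exact: has_deriv_real. Qed.
Lemma rderiv_cos x : rderiv (@cos R) x (- sin x). Proof. exact: has_deriv_real. Qed.

Lemma rderiv_sinM p x : rderiv (fun z => sin (p * z)) x (p * cos (p * x)).
Proof.
have := rderiv_comp p 0 x rderiv_sin.
rewrite !addr0; congr (rderiv _ _ _); apply/funext => z; by rewrite addr0.
Qed.

Lemma rderiv_cosM p x : rderiv (fun z => cos (p * z)) x (- (p * sin (p * x))).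
Proof.
have := rderiv_comp p 0 x rderiv_cos.
rewrite !addr0 mulrN; congr (rderiv _ _ _); apply/funext => z; by rewrite addr0.
Qed.

Lemma rderiv_is_derive f x l : rderiv f x l -> is_derive x 1 f l.
Proof.
move=> H.
have K : h^-1 *: (f (h *: 1 + x) - f x) @[h --> 0^'] --> l.
  apply/cvgrPdist_lt => e e0.
  have [|dl dl0 Hd] := H (e / 2); first by rewrite divr_gt0.
  apply/nbhs_ballP; exists dl => //= h; rewrite /ball /= sub0r normrN => hdl h0.
  have := Hd (h + x) I; rewrite addrK => /(_ hdl).
  rewrite -rmorphB -rmorphM -rmorphB /= normc_real => Hn.
  rewrite /GRing.scale /= mulr1 distrC.
  have -> : h^-1 * (f (h + x) - f x) - l = h^-1 * (f (h + x) - f x - h * l).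
    by rewrite [in RHS]mulrBr mulKf.
  rewrite normrM normfV mulrC ltr_pdivrMr ?normr_gt0//.
  apply: le_lt_trans Hn _; rewrite ltr_pM2r ?normr_gt0//.
  by rewrite ltr_pdivrMr// ltr_pMr// ltr1n.
by apply: DeriveDef; [apply/cvg_ex; exists l|exact/cvg_lim].
Qed.

Lemma rderiv_continuous f (f' : R -> R) : (forall x, rderiv f x (f' x)) -> continuous f.
Proof.
move=> H x; apply: differentiable_continuous; apply/derivable1_diffP.
by have [] := rderiv_is_derive (H x).
Qed.

Lemma Rintegral_FTC f F (c d : R) : c <= d -> continuous f ->
  (forall x, rderiv F x (f x)) ->
  \int[lebesgue_measure]_(t in `[c, d]) f t = F d - F c.
Proof.
rewrite le_eqVlt => /orP[/eqP <-|cd] cf dF.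
  by rewrite subrr set_itv1 /Rintegral integral_set1.
rewrite /Rintegral (@continuous_FTC2 _ f F) //.
- exact: continuous_subspaceT.
- split.
  + by move=> x _; have [] := rderiv_is_derive (dF x).
  + by apply: cvg_at_right_filter; exact: (rderiv_continuous dF).
  + by apply: cvg_at_left_filter; exact: (rderiv_continuous dF).
- by move=> x _; rewrite derive1E; have [] := rderiv_is_derive (dF x).
Qed.
End real_calculus.

(** The shifted data in the variable [s] of [0, l], [l = pi - 5 b]:
    [es s = e0 (3 b + s)], [Es] its primitive, [hs s = h0 (5 b + s)],
    [ks s = K_h0 (5 b + s)]; [es1] and [es2] are derivatives of [es]. *)
Section profiles.
Variables (R : realType) (l : R).
Hypothesis l0 : 0 < l.
Implicit Types (s x : R).

Definition omega : R := pi / l.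
Definition k_freq : R := pi * Num.sqrt 10 / (2 * l).
Definition k_ampl : R := 3 * pi / (l * Num.sqrt 10).
Definition es s : R := sin (2 * omega * s) + 2 * sin (omega * s).
Definition es1 s : R := omega * (2 * cos (2 * omega * s) + 2 * cos (omega * s)).
Definition es2 s : R := - omega ^+ 2 * (4 * sin (2 * omega * s) + 2 * sin (omega * s)).
Definition Es s : R := omega^-1 * (2^-1 * (1 - cos (2 * omega * s)) + 2 * (1 - cos (omega * s))).
Definition ks s : R := k_ampl * sin (k_freq * (l - s)).
Definition hs s : R := k_ampl * k_freq * cos (k_freq * (l - s)).

Let omega0 : omega != 0.
Proof. by rewrite mulf_neq0 ?invr_eq0 ?gt_eqF ?pi_gt0. Qed.
Let s10 : Num.sqrt 10 ^+ 2 = 10 :> R. Proof. by rewrite sqr_sqrtr. Qed.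
Let s10n0 : Num.sqrt 10 != 0 :> R. Proof. by rewrite gt_eqF// sqrtr_gt0. Qed.

Lemma k_ampl_freq : k_ampl * k_freq = 3 * pi ^+ 2 / (2 * l ^+ 2).
Proof.
rewrite /k_ampl /k_freq; field.
by rewrite s10n0 gt_eqF.
Qed.

Lemma Es_deriv s : rderiv Es s (es s).
Proof.
apply: rderiv_eq (rderivZ _ (rderivD (rderivZ _ (rderivB (rderiv_cst _ _) (rderiv_cosM (2 * omega) s)))
  (rderivZ _ (rderivB (rderiv_cst _ _) (rderiv_cosM omega s))))) _.
by rewrite /es; field.
Qed.

Lemma es_deriv s : rderiv es s (es1 s).
Proof.
apply: rderiv_eq (rderivD (rderiv_sinM (2 * omega) s) (rderivZ _ (rderiv_sinM omega s))) _.
by rewrite /es1; ring.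
Qed.

Let flip (f : R -> R) (f' : R -> R) s : (forall y, rderiv f y (f' y)) ->
  rderiv (fun z => f (k_freq * (l - z))) s (- k_freq * f' (k_freq * (l - s))).
Proof.
move=> H; have E z : - k_freq * z + k_freq * l = k_freq * (l - z) by ring.
have := rderiv_comp (- k_freq) (k_freq * l) s H.
by rewrite E; congr (rderiv _ _ _); apply/funext => z; rewrite E.
Qed.

Lemma ks_deriv s : rderiv ks s (- hs s).
Proof.
apply: rderiv_eq (rderivZ _ (flip s (@rderiv_sin R))) _.
by rewrite /hs; ring.
Qed.

Lemma hs_deriv s : rderiv hs s (k_freq ^+ 2 * ks s).
Proof.
apply: rderiv_eq (rderivZ _ (flip s (@rderiv_cos R))) _.
by rewrite /ks; ring.
Qed.

Lemma es1_deriv s : rderiv es1 s (es2 s).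
Proof.
apply: rderiv_eq (rderivZ _ (rderivD (rderivZ _ (rderiv_cosM (2 * omega) s))
  (rderivZ _ (rderiv_cosM omega s)))) _.
by rewrite /es2; ring.
Qed.

Lemma Es_0 : Es 0 = 0. Proof. by rewrite /Es !mulr0 cos0 subrr !mulr0 addr0 mulr0. Qed.
Lemma es_0 : es 0 = 0. Proof. by rewrite /es !mulr0 sin0 mulr0 addr0. Qed.
Let omegal : omega * l = pi. Proof. by rewrite /omega divfK// gt_eqF. Qed.
Let omega2l : 2 * omega * l = pi *+ 2. Proof. by rewrite -mulrA omegal mulr_natl. Qed.
Lemma es_l : es l = 0.
Proof. by rewrite /es omega2l omegal sin2pi sinpi mulr0 addr0. Qed.
Lemma ks_l : ks l = 0. Proof. by rewrite /ks subrr mulr0 sin0 mulr0. Qed.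
Lemma hs_l : hs l = k_ampl * k_freq. Proof. by rewrite /hs subrr mulr0 cos0 mulr1. Qed.

(** In terms of [theta = omega * s] both sides are combinations of [1], [cos theta]
    and [cos (2 theta)]; the factor [10] under the root, i.e.
    [k_freq ^+ 2 = 5 / 2 * omega ^+ 2], and the weights [1], [2] in [es] make the
    coefficients agree. *)
Lemma profile_ode s : - es1 (l - s) + k_freq ^+ 2 * (Es l - Es (l - s)) = k_ampl * k_freq * Es s.
Proof.
have c1 : cos (omega * (l - s)) = - cos (omega * s).
  by rewrite mulrBr omegal cosB cospi sinpi; ring.
have c2 : cos (2 * omega * (l - s)) = cos (2 * omega * s).
  by rewrite mulrBr omega2l cosB cos2pi sin2pi; ring.
have mu2 : k_freq ^+ 2 = 5 / 2 * omega ^+ 2.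
  rewrite /k_freq /omega !expr_div_n !exprMn s10; field.
  by rewrite gt_eqF.
have km : k_ampl * k_freq = 3 / 2 * omega ^+ 2.
  rewrite k_ampl_freq /omega; field; by rewrite gt_eqF.
rewrite mu2 km /es1 /Es c1 c2 omega2l omegal cospi cos2pi.
by field.
Qed.
End profiles.

(** * The potentials in shifted variables *)

Section first_response_ode.
Variables (R : realType) (lam : R[i]) (S C : R -> R[i]).
Hypothesis SC : trig_pair lam S C.
Variables (b : R) (E e : R -> R[i]).
Hypothesis dE : forall x, has_deriv setT E x (e x).

Definition first_response1 s : R[i] := E s * S (1 * s + b) -
  (C (1 * s + - b) * cint 0 s (fun t => E t * C (2 * t + 0)) +
   lam * S (1 * s + - b) * cint 0 s (fun t => E t * S (2 * t + 0))).

Let cE x : cont_at setT E x. Proof. exact: has_deriv_cont (dE x). Qed.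
Let cEC x : cont_at setT (fun t => E t * C (2 * t + 0)) x.
Proof. by apply: cont_atM => //; exact: has_deriv_cont (has_deriv_affine setT 2 0 x (trig_dC SC)). Qed.
Let cES x : cont_at setT (fun t => E t * S (2 * t + 0)) x.
Proof. by apply: cont_atM => //; exact: has_deriv_cont (has_deriv_affine setT 2 0 x (trig_dS SC)). Qed.

Let HS s : S (1 * s + b) = - (S (1 * s + - b) * C (2 * s + 0) - C (1 * s + - b) * S (2 * s + 0)).
Proof. by rewrite -(trig_subS SC) -(trig_opp SC _).1; congr S; ring. Qed.
Let HC s : C (1 * s + b) = C (1 * s + - b) * C (2 * s + 0) + lam * S (1 * s + - b) * S (2 * s + 0).
Proof. by rewrite -(trig_subC SC) -(trig_opp SC (_ - _)).2; congr C; ring. Qed.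

Lemma first_response_deriv s : has_deriv setT (first_response S C b E) s (first_response1 s).
Proof.
have dS1 := has_deriv_affine setT 1 (- b) s (trig_dS SC).
have dC1 := has_deriv_affine setT 1 (- b) s (trig_dC SC).
apply: has_deriv_eq (has_derivN (has_derivB
   (has_derivM dS1 (cint_deriv s cEC)) (has_derivM dC1 (cint_deriv s cES)))) _.
rewrite /first_response1 HS rmorph1; ring.
Qed.

Lemma first_response1_deriv s :
  has_deriv setT first_response1 s (e s * S (1 * s + b) - lam * first_response S C b E s).
Proof.
have dS1 := has_deriv_affine setT 1 (- b) s (trig_dS SC).
have dC1 := has_deriv_affine setT 1 (- b) s (trig_dC SC).
apply: has_deriv_eq (has_derivB
  (has_derivM (dE s) (has_deriv_affine setT 1 b s (trig_dS SC)))
  (has_derivD (has_derivM dC1 (cint_deriv s cEC))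
    (has_derivM (has_derivM (has_deriv_cst _ lam _) dS1) (cint_deriv s cES)))) _.
rewrite HC /first_response rmorph1; ring.
Qed.

Lemma first_response_0 : first_response S C b E 0 = 0.
Proof. by rewrite /first_response !cint_nil; ring. Qed.
Lemma first_response1_0 : E 0 = 0 -> first_response1 0 = 0.
Proof. by move=> E0; rewrite /first_response1 !cint_nil E0; ring. Qed.
End first_response_ode.

(** The parameter is [b = a / 2], so that every break point is an integral
    combination of [b] and [pi]. *)
Section potentials.
Variables (R : realType) (b : R).
Hypothesis hb1 : pi / 6 <= b.
Hypothesis hb2 : b < pi / 5.
Local Notation l := (pi - 5 * b).
Local Notation a := (2 * b).
Implicit Types (x : R) (g : R -> R[i]) (alpha beta : R[i]).

Let pi0 : 0 < pi :> R. Proof. exact: pi_gt0. Qed.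
Let l0 : 0 < l. Proof. by move: hb2; lra. Qed.
Let b0 : 0 < b. Proof. by move: hb1 pi0; lra. Qed.

Lemma e0E x : e0 a x = es l (x - 3 * b).
Proof.
have l2 : pi - 5 * b != 0 by rewrite gt_eqF.
have l3 : 2 * pi - 5 * (2 * b) != 0 by rewrite gt_eqF//; move: l0; lra.
rewrite /e0 /es /omega; congr (sin _ + 2 * sin _);
  by move: (pi : R) l2 l3 => p l2 l3; field; rewrite l2 l3.
Qed.

Lemma h0E x : h0 a x = hs l (x - 5 * b).
Proof.
have l2 : pi - 5 * b != 0 by rewrite gt_eqF.
have l3 : 2 * pi - 5 * (2 * b) != 0 by rewrite gt_eqF//; move: l0; lra.
rewrite /h0 /hs k_ampl_freq // /k_freq; congr (_ * cos _);
  by move: (pi : R) l2 l3 => p l2 l3; field; rewrite l2 l3.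
Qed.

Lemma K_h0E x : x <= pi -> K_h0 a x = ks l (x - 5 * b).
Proof.
move=> xpi; rewrite /K_h0 (_ : h0 a = fun x => hs l (x - 5 * b)); last first.
  by apply/funext => t; rewrite h0E.
rewrite (@Rintegral_FTC _ _ (fun t => - ks l (t - 5 * b)))//.
- by rewrite ks_l oppr0 add0r opprK.
- exact: (rderiv_continuous (fun t => rderiv_shift (5 * b) t (hs_deriv l))).
move=> t; apply: rderiv_eq.
  rewrite (_ : (fun t => _) = (fun t => -1 * ks l (t - 5 * b))).
    exact: rderivZ (rderiv_shift (5 * b) t (ks_deriv l)).
  by apply/funext => z; rewrite mulN1r.
by rewrite mulN1r opprK.
Qed.

Lemma E0E x : 4 * b <= x ->
  \int[lebesgue_measure]_(t in `[3 * a / 2, x - a / 2]%classic) e0 a t = Es l (x - 4 * b).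
Proof.
move=> xb; rewrite (_ : e0 a = fun x => es l (x - 3 * b)); last first.
  by apply/funext => t; rewrite e0E.
rewrite (@Rintegral_FTC _ _ (fun t => Es l (t - 3 * b))).
- have -> : 3 * a / 2 - 3 * b = 0 by field.
  by rewrite Es_0 subr0; congr (Es _ _); field.
- lra.
- exact: (rderiv_continuous (fun t => rderiv_shift (3 * b) t (es_deriv l))).
- by move=> t; exact: (rderiv_shift (3 * b) t (Es_deriv l0)).
Qed.

Definition clamp x : R := Num.max 0 (Num.min l x).
Lemma clamp_continuous : continuous clamp.
Proof.
move=> x; apply: continuous_max; first exact: cst_continuous.
by apply: continuous_min; [exact: cst_continuous|exact: cvg_id].
Qed.
Lemma clamp_lo x : x <= 0 -> clamp x = 0.
Proof.
by move=> x0; rewrite /clamp; apply/max_idPl; rewrite ge_min x0 orbT.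
Qed.
Lemma clamp_hi x : l <= x -> clamp x = l.
Proof. by move=> lx; rewrite /clamp (min_idPl lx); apply/max_idPr/ltW. Qed.
Lemma clamp_id x : 0 <= x <= l -> clamp x = x.
Proof. by move=> /andP[x0 xl]; rewrite /clamp (min_idPr xl); apply/max_idPr. Qed.

(** Both bumps vanish at the ends of their supports, so clamping the argument extends
    them by zero to continuous functions on the line. *)
Definition q_slope x : R[i] := (es l (clamp (x - 3 * b)))%:C
  - (ks l (clamp (x - 4 * b)) * Es l (clamp (x - 4 * b)))%:C.

Lemma q_pot_lo g alpha x : x < 3 * b -> q_pot a g alpha x = 0.
Proof.
move: l0 b0 hb1 hb2 => ? ? ? ? x3; rewrite /q_pot !in_itv /=.
by do 4![case: ifP => [/andP[? ?]|_]; first by exfalso; lra].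
Qed.

Lemma q_pot_e g alpha x : 3 * b <= x < pi - 2 * b ->
  q_pot a g alpha x = alpha * (es l (x - 3 * b))%:C.
Proof.
move=> /andP[x1 x2]; rewrite /q_pot !in_itv /= ifT ?e0E//.
by apply/andP; split; lra.
Qed.

Lemma q_pot_gap g alpha x : pi - 2 * b <= x < 4 * b -> q_pot a g alpha x = 0.
Proof.
move: l0 b0 hb1 hb2 => ? ? ? ? /andP[x1 x2]; rewrite /q_pot !in_itv /=.
by do 4![case: ifP => [/andP[? ?]|_]; first by exfalso; lra].
Qed.

Lemma q_pot_kE g alpha x : 4 * b <= x < pi - b ->
  q_pot a g alpha x = - alpha * (ks l (x - 4 * b))%:C * (Es l (x - 4 * b))%:C.
Proof.
move: hb1 hb2 pi0 => ? ? ? /andP[x1 x2]; rewrite /q_pot !in_itv /=.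
case: ifP => [/andP[? ?]|_]; first by exfalso; lra.
rewrite ifT; last by apply/andP; split; lra.
rewrite E0E// K_h0E; last by lra.
by congr (_ * (ks _ _)%:C * _); field.
Qed.

Lemma q_pot_g g alpha x : pi - b <= x < 5 * b -> q_pot a g alpha x = g x.
Proof.
move: hb1 hb2 pi0 => ? ? ? /andP[x1 x2]; rewrite /q_pot !in_itv /=.
do 2![case: ifP => [/andP[? ?]|_]; first by exfalso; lra].
by rewrite ifT//; apply/andP; split; lra.
Qed.

Lemma q_pot_h g alpha x : 5 * b <= x <= pi -> q_pot a g alpha x = (hs l (x - 5 * b))%:C.
Proof.
move: hb1 hb2 pi0 => ? ? ? /andP[x1 x2]; rewrite /q_pot !in_itv /=.
do 3![case: ifP => [/andP[? ?]|_]; first by exfalso; lra].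
by rewrite ifT ?h0E//; apply/andP; split; lra.
Qed.

Let slope_e_lo x : x <= 3 * b -> es l (clamp (x - 3 * b)) = 0.
Proof. by move=> H; rewrite clamp_lo ?es_0//; lra. Qed.
Let slope_e_hi x : pi - 2 * b <= x -> es l (clamp (x - 3 * b)) = 0.
Proof. by move=> H; rewrite clamp_hi ?es_l//; lra. Qed.
Let slope_kE_lo x : x <= 4 * b -> ks l (clamp (x - 4 * b)) * Es l (clamp (x - 4 * b)) = 0.
Proof. by move=> H; rewrite clamp_lo ?Es_0 ?mulr0//; lra. Qed.
Let slope_kE_hi x : pi - b <= x -> ks l (clamp (x - 4 * b)) * Es l (clamp (x - 4 * b)) = 0.
Proof. by move=> H; rewrite clamp_hi ?ks_l ?mul0r//; lra. Qed.

Lemma q_slope_lo x : x <= 3 * b -> q_slope x = 0.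
Proof. by move=> H; rewrite /q_slope slope_e_lo// slope_kE_lo ?subr0//; move: b0; lra. Qed.
Lemma q_slope_hi x : pi - b <= x -> q_slope x = 0.
Proof. by move=> H; rewrite /q_slope slope_e_hi ?slope_kE_hi ?subr0//; move: b0; lra. Qed.

Lemma q_slope_mid x : pi - 2 * b <= x <= 4 * b -> q_slope x = 0.
Proof. by move=> /andP[? ?]; rewrite /q_slope slope_e_hi ?slope_kE_lo ?subr0. Qed.

(** The pieces of [q_slope] are disjoint from the part of the potential that carries
    [g] and [h0]. *)
Lemma q_pot_affine g alpha x : 0 <= x <= pi ->
  q_pot a g alpha x = q_pot a g 0 x + alpha * q_slope x.
Proof.
move: hb1 hb2 pi0 => ? ? ? /andP[x0 xpi].
have [x1|x1] := ltP x (3 * b).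
  by rewrite !q_pot_lo// q_slope_lo ?(ltW x1)// mulr0 addr0.
have [x2|x2] := ltP x (pi - 2 * b).
  rewrite !q_pot_e ?x1// mul0r add0r /q_slope slope_kE_lo ?subr0; last by lra.
  by rewrite clamp_id//; apply/andP; split; lra.
have [x3|x3] := ltP x (4 * b).
  by rewrite !q_pot_gap ?x2// q_slope_mid ?x2 ?ltW// mulr0 addr0.
have [x4|x4] := ltP x (pi - b).
  rewrite !q_pot_kE ?x3// oppr0 !mul0r add0r /q_slope slope_e_hi// clamp_id;
    last by apply/andP; split; lra.
  have -> : (ks l (x - 4 * b) * Es l (x - 4 * b))%:C =
    (ks l (x - 4 * b))%:C * (Es l (x - 4 * b))%:C by rewrite rmorphM.
  have -> : (0 : R)%:C = 0 :> R[i] by []. by rewrite sub0r mulrN !mulNr mulrA.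
have [x5|x5] := ltP x (5 * b).
  by rewrite !q_pot_g ?x4// q_slope_hi// mulr0 addr0.
by rewrite !q_pot_h ?x5// q_slope_hi// mulr0 addr0.
Qed.
End potentials.

(** * The correction between two members of the family *)

Section correction.
Variables (R : realType) (b : R).
Hypothesis hb1 : pi / 6 <= b.
Hypothesis hb2 : b < pi / 5.
Local Notation l := (pi - 5 * b).
Local Notation a := (2 * b).
Local Notation clamp := (clamp b).
Variables (lam : R[i]) (S C : R -> R[i]).
Hypothesis SC : trig_pair lam S C.
Implicit Types (x : R) (g : R -> R[i]) (alpha beta : R[i]).

Let pi0 : 0 < pi :> R. Proof. exact: pi_gt0. Qed.
Let l0 : 0 < l. Proof. by move: hb2; lra. Qed.
Let b0 : 0 < b. Proof. by move: hb1 pi0; lra. Qed.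
Let bds : [/\ 0 < b, 0 < l, l <= b & (0 : R) < pi].
Proof. by split=> //; move: hb1; lra. Qed.

Let cS := trig_contS SC.
Let cC := trig_contC SC.

Definition Ec s : R[i] := (Es l s)%:C.
Definition ec s : R[i] := (es l s)%:C.
Definition kc s : R[i] := (ks l s)%:C.
Definition hc s : R[i] := (hs l s)%:C.

Let dE x : has_deriv setT Ec x (ec x). Proof. exact: Es_deriv. Qed.
Let de x : has_deriv setT ec x (es1 l x)%:C. Proof. exact: es_deriv. Qed.
Let dk x : has_deriv setT kc x (- hc x).
Proof. by rewrite /hc -rmorphN; exact: ks_deriv. Qed.
Let dh x : has_deriv setT hc x ((k_freq l ^+ 2)%:C * kc x).
Proof. by rewrite /kc -rmorphM; exact: hs_deriv. Qed.
Let ce1 x : cont_at setT (fun s => (es1 l s)%:C) x.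
Proof. exact: has_deriv_cont (es1_deriv l x). Qed.
Let cE x : cont_at setT Ec x. Proof. exact: has_deriv_cont (dE x). Qed.
Let ce x : cont_at setT ec x. Proof. exact: has_deriv_cont (de x). Qed.
Let ck x : cont_at setT kc x. Proof. exact: has_deriv_cont (dk x). Qed.
Let ch x : cont_at setT hc x. Proof. exact: has_deriv_cont (dh x). Qed.

Let shift_cont (q : R) : continuous (fun x : R => x - q).
Proof. by move=> x; apply: cvgB; [exact: cvg_id|exact: cvg_cst]. Qed.
Let clamp_shift (q : R) : continuous (fun x : R => clamp (x - q)).
Proof. by move=> x; exact: (continuous_comp (@shift_cont q x) (@clamp_continuous _ b _)). Qed.
Let cSa x : cont_at setT (fun t => S (t - a)) x.
Proof. by apply: cont_at_comp => //; exact: shift_cont. Qed.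

Definition early_source_e x : R[i] := ec (clamp (x - 3 * b)) * S (x - a).
Definition early_source_kE x : R[i] := kc (clamp (x - 4 * b)) * Ec (clamp (x - 4 * b)) * S (x - a).
Definition early_source x : R[i] := early_source_e x - early_source_kE x.

Let c_early_e x : cont_at setT early_source_e x.
Proof. by apply: cont_atM => //; apply: cont_at_comp => //; exact: clamp_shift. Qed.
Let c_early_kE x : cont_at setT early_source_kE x.
Proof.
by apply: cont_atM => //; apply: cont_atM; apply: cont_at_comp => //; exact: clamp_shift.
Qed.
Let c_early x : cont_at setT early_source x.
Proof. by apply: cont_atD => //; exact: cont_atN. Qed.

Lemma early_sourceE x : early_source x = q_slope b x * S (x - a).
Proof. by rewrite /early_source /early_source_e /early_source_kE /q_slope rmorphM mulrBl. Qed.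

(** The part of the correction caused by [q_slope] alone; on [0, 5 b] it is the whole
    correction. *)
Definition early_correction := duhamel S C early_source.
Let c_correction x : cont_at setT early_correction x. Proof. exact: (duhamel_cont SC). Qed.

(** For [x >= 5 b] this is the delayed term [h0 x * W (x - a)]; the maximum extends it
    by zero, since [early_correction] vanishes at [3 b = 5 b - a]. *)
Definition late_source x : R[i] := hc (x - 5 * b) * early_correction (Num.max x (5 * b) - a).

Let c_late x : cont_at setT late_source x.
Proof.
apply: cont_atM; first by apply: cont_at_comp => //; exact: shift_cont.
apply: (@cont_at_comp _ early_correction (fun x => Num.max x (5 * b) - a)) => //.
have cmax : continuous (fun x : R => Num.max x (5 * b)).
  move=> y; apply: (@continuous_max R R (fun z => z) (fun=> 5 * b) y); first exact: cvg_id.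
  exact: cst_continuous.
by apply: cvgB; [exact: cmax|exact: cvg_cst].
Qed.

Definition source x : R[i] := early_source x + late_source x.
Let c_source x : cont_at setT source x. Proof. exact: cont_atD. Qed.

Lemma early_correction_eq0 x : 0 <= x <= 3 * b -> early_correction x = 0.
Proof.
move=> /andP[x0 x3]; have [] // := duhamel_eq0 SC x0 c_early _.
by move=> t /andP[_ tx]; rewrite early_sourceE q_slope_lo ?mul0r// (le_trans tx).
Qed.

Lemma late_source_eq0 x : x <= 5 * b -> late_source x = 0.
Proof.
move=> x5; rewrite /late_source (max_idPr x5) early_correction_eq0 ?mulr0//.
by have [? ? ? ?] := bds; apply/andP; split; lra.
Qed.

(** Both sides solve the same initial value problem on [0, l]. *)
Lemma early_correctionE s : 0 <= s <= l -> early_correction (1 * s + 3 * b) = first_response S C b Ec s.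
Proof.
move=> sl; have [? ? ? ?] := bds.
pose Z0 s := early_correction (1 * s + 3 * b) - first_response S C b Ec s.
pose Z1 s := duhamel1 lam S C early_source (1 * s + 3 * b) - first_response1 lam S C b Ec s.
suff [H _] : Z0 s = 0 /\ Z1 s = 0 by apply/eqP; rewrite -subr_eq0; apply/eqP.
have dZ0 x : has_deriv setT Z0 x (Z1 x).
  apply: has_deriv_eq (has_derivB
    (has_deriv_affine setT 1 (3 * b) x (fun y => duhamel_deriv SC y c_early))
    (first_response_deriv SC b dE x)) _.
  rewrite rmorph1 /Z1; ring.
have dZ1 x : 0 <= x <= l -> has_deriv setT Z1 x (- lam * Z0 x).
  move=> /andP[x0 xl].
  apply: has_deriv_eq (has_derivB
    (has_deriv_affine setT 1 (3 * b) x (fun y => duhamel1_deriv SC y c_early))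
    (first_response1_deriv SC b dE x)) _.
  have -> : early_source (1 * x + 3 * b) = ec x * S (1 * x + b).
    rewrite /early_source /early_source_e /early_source_kE [clamp (_ - 4 * b)]clamp_lo; last by lra.
    rewrite [X in _ - _ * X * _](_ : _ = 0) ?mulr0 ?mul0r ?subr0; last by rewrite /Ec Es_0.
    have -> : 1 * x + 3 * b - 3 * b = x by ring.
    rewrite clamp_id ?x0//; congr (_ * S _); ring.
  rewrite rmorph1 /Z0 /early_correction; ring.
have H := @homogeneous_zero _ _ _ _ SC l l Z0 Z1 (lexx _) _ _ _ _ _ s sl; apply: H.
- by move=> x _; exact: has_deriv_sub (dZ0 x).
- apply: (@C1_ac _ _ _ _ (fun x => - lam * Z0 x)); first exact: ltW.
    by move=> x x0l; exact: has_deriv_sub (dZ1 x x0l).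
  move=> x _; apply: cont_at_sub; apply: cont_atM; last exact: has_deriv_cont (dZ0 x).
  exact: has_deriv_cont (has_deriv_cst _ _ _).
- by apply: aeW => x; rewrite in_itv/= => /andP[? ?]; apply: has_deriv_sub (dZ1 x _) => //; rewrite !ltW.
- rewrite /Z0 first_response_0 mulr0 add0r early_correction_eq0 ?subrr//; apply/andP; split; lra.
- rewrite /Z1 first_response1_0 ?mulr0 ?add0r; last by rewrite /Ec Es_0.
  have b3 : 0 <= 3 * b by lra.
  have [|_ ->] := duhamel_eq0 SC b3 c_early; last by rewrite subrr.
  by move=> t /andP[_ tx]; rewrite early_sourceE q_slope_lo ?mul0r.
Qed.

Let early_source_eE s : 0 <= s <= l -> early_source_e (1 * s + 3 * b) = ec s * S (1 * s + b).
Proof.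
move=> sl; rewrite /early_source_e.
have -> : 1 * s + 3 * b - 3 * b = s by ring.
rewrite clamp_id//; congr (_ * S _); ring.
Qed.

Let early_source_kEE s : 0 <= s <= l ->
  early_source_kE (1 * s + 4 * b) = kc s * Ec s * S (1 * s + 2 * b).
Proof.
move=> sl; rewrite /early_source_kE.
have -> : 1 * s + 4 * b - 4 * b = s by ring.
rewrite clamp_id//; congr (_ * S _); ring.
Qed.

Let late_sourceE s : 0 <= s <= l -> late_source (1 * s + 5 * b) = hc s * first_response S C b Ec s.
Proof.
move=> /andP[s0 sl]; rewrite /late_source.
have -> : 1 * s + 5 * b - 5 * b = s by ring.
have -> : Num.max (1 * s + 5 * b) (5 * b) = 1 * s + 5 * b by apply/max_idPl; lra.
rewrite -early_correctionE ?s0//; congr (_ * early_correction _); ring.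
Qed.

(** After shifts to [0, l] the three parts of the source are the three integrals of
    [green_identity]. *)
Lemma source_orthogonal (U V : R -> R[i]) :
  (forall x, has_deriv setT U x (V x)) ->
  (forall x, has_deriv setT V x (- lam * U x)) ->
  (forall x y, U (x + y) = U x * C y + V x * S y) ->
  (forall x y, V (x + y) = V x * C y - lam * U x * S y) ->
  cint 0 pi (fun t => U t * source t) = 0.
Proof.
move=> dU dV addU addV; have [? ? lb ?] := bds.
have cU x : cont_at setT U x := has_deriv_cont (dU x).
have cUF G : (forall x, cont_at setT G x) -> forall x, cont_at setT (fun t => U t * G t) x.
  by move=> cG x; exact: cont_atM.
have cUa (p q : R) x : cont_at setT (fun s => U (p * s + q)) x.
  by apply: cont_at_comp => //; exact: affine_continuous.
have cSb (p q : R) x : cont_at setT (fun s => S (p * s + q)) x.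
  by apply: cont_at_comp => //; exact: affine_continuous.
have -> : cint 0 pi (fun t => U t * source t) = cint 0 pi (fun t => U t * early_source_e t) -
    cint 0 pi (fun t => U t * early_source_kE t) + cint 0 pi (fun t => U t * late_source t).
  rewrite (@cint_FTC_global _ _ _ _ (fun x => antider (fun t => U t * early_source_e t) x -
     antider (fun t => U t * early_source_kE t) x + antider (fun t => U t * late_source t) x)).
  - by rewrite /cint; ring.
  - exact: cUF.
  - move=> x; apply: has_deriv_eq (has_derivD (has_derivB (antider_deriv x (cUF _ c_early_e))
      (antider_deriv x (cUF _ c_early_kE))) (antider_deriv x (cUF _ c_late))) _.
    rewrite /source /early_source; ring.
rewrite (@cint_support _ l (3 * b) pi (fun t => U t * early_source_e t)
  (fun s => U (1 * s + 3 * b) * ec s * S (1 * s + b))); first last.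
- by move=> s sl; rewrite early_source_eE// mulrA.
- by move=> x /andP[x1 x2]; rewrite /early_source_e clamp_hi /ec ?es_l ?mul0r ?mulr0//; lra.
- by move=> x /andP[x1 x2]; rewrite /early_source_e clamp_lo /ec ?es_0 ?mul0r ?mulr0//; lra.
- by move=> x; apply: cont_atM => //; exact: cont_atM.
- exact: cUF.
- lra.
- lra.
- lra.
rewrite (@cint_support _ l (4 * b) pi (fun t => U t * early_source_kE t)
  (fun s => U (1 * s + 4 * b) * (kc s * Ec s) * S (1 * s + 2 * b))); first last.
- by move=> s sl; rewrite early_source_kEE// !mulrA.
- by move=> x /andP[x1 x2]; rewrite /early_source_kE clamp_hi /kc ?ks_l ?mul0r ?mulr0//; lra.
- by move=> x /andP[x1 x2]; rewrite /early_source_kE clamp_lo /Ec ?Es_0 ?mulr0 ?mul0r ?mulr0//; lra.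
- by move=> x; apply: cont_atM => //; apply: cont_atM => //; exact: cont_atM.
- exact: cUF.
- lra.
- lra.
- lra.
have cwk x : cont_at setT (first_response S C b Ec) x := has_deriv_cont (first_response_deriv SC b dE x).
have -> : cint 0 pi (fun t => U t * late_source t) =
    cint 0 l (fun s => U (1 * s + 5 * b) * hc s * first_response S C b Ec s).
  rewrite -(cint_add 0 (5 * b)) cint_eq0 ?add0r; [|lra|exact: cUF|]; last first.
    by move=> x /andP[x1 x2]; rewrite late_source_eq0// mulr0.
  rewrite -[X in cint _ X](subrK (5 * b)); apply: cint_shift; [lra|exact: cUF| |].
    by move=> x; apply: cont_atM => //; exact: cont_atM.
  by move=> s sl; rewrite late_sourceE// mulrA.
apply: (green_identity SC dU dV addU addV b
  (M2 := (k_freq l ^+ 2)%:C) (c := (k_ampl l * k_freq l)%:C) dE de ce1 dk dh).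
- by rewrite /Ec Es_0.
- by rewrite /kc ks_l.
- by rewrite /hc hs_l.
- by rewrite /ec es_l.
- rewrite (inj_eq (@complexI R) _ 0) k_ampl_freq // gt_eqF// divr_gt0//
    mulr_gt0//; last exact: exprn_gt0.
  exact: exprn_gt0.
- move=> x; rewrite -rmorphN -rmorphB -!rmorphM -rmorphD /=.
  by rewrite profile_ode.
Qed.

Lemma correction_end : duhamel S C source pi = 0 /\ duhamel1 lam S C source pi = 0.
Proof.
have IC : cint 0 pi (fun t => C t * source t) = 0.
  apply: (@source_orthogonal C (fun x => - lam * S x)).
  - exact: (trig_dC SC).
  - move=> x; apply: has_deriv_eq (has_derivM (has_deriv_cst _ _ _) (trig_dS SC x)) _; ring.
  - by move=> x y; rewrite (trig_addC SC); ring.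
  - by move=> x y; rewrite (trig_addS SC); ring.
have IS : cint 0 pi (fun t => S t * source t) = 0.
  apply: (@source_orthogonal S C).
  - exact: (trig_dS SC).
  - exact: (trig_dC SC).
  - by move=> x y; rewrite (trig_addS SC).
  - by move=> x y; rewrite (trig_addC SC).
by rewrite /duhamel /duhamel1 IC IS !mulr0 subrr addr0.
Qed.

Lemma correction_start x : 0 <= x <= 3 * b -> duhamel S C source x = 0.
Proof.
move=> /andP[x0 x3]; have [? ? ? ?] := bds.
have [] // := duhamel_eq0 SC x0 c_source _ => t /andP[_ tx].
by rewrite /source early_sourceE q_slope_lo ?(le_trans tx)// late_source_eq0 ?mul0r ?addr0//; lra.
Qed.

Lemma correction_early x : 0 <= x <= 5 * b -> duhamel S C source x = early_correction x.
Proof.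
move=> /andP[x0 x5].
have [] // := @eq_duhamel _ _ _ _ SC source early_source x x0 c_source c_early _ => t /andP[_ tx].
by rewrite /source late_source_eq0 ?addr0// (le_trans tx).
Qed.

(** [source] is what the correction has to balance: past [5 b] the potential is [h0]
    and the delayed argument is still in [3 b, 5 b], before it either the
    potential or the delayed correction is zero. *)
Lemma correction_sourceE g beta (Y0 : R -> R[i]) x : 0 < x < pi ->
  (forall t, 0 <= t <= 3 * b -> Y0 t = S t) ->
  source x = q_slope b x * Y0 (x - a) + q_pot a g beta x * duhamel S C source (x - a).
Proof.
move=> /andP[x0 xpi] HY; have [? ? ? ?] := bds.
rewrite /source early_sourceE; congr (_ + _).
  have [x3|x3] := leP x (3 * b); first by rewrite q_slope_lo// !mul0r.
  have [x4|x4] := leP (pi - b) x; first by rewrite q_slope_hi// !mul0r.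
  by rewrite HY//; apply/andP; split; lra.
have [x3|x3] := ltP x (3 * b).
  by rewrite q_pot_lo// mul0r late_source_eq0//; lra.
have [x5|x5] := ltP x (5 * b).
  by rewrite late_source_eq0 ?ltW// correction_start ?mulr0//; apply/andP; split; lra.
rewrite (q_pot_h hb1 hb2); last by rewrite x5 ltW.
rewrite correction_early; last by apply/andP; split; lra.
by rewrite /late_source (max_idPl x5).
Qed.

Lemma shift_delay_solution g alpha beta (Y : 'I_2 -> R -> R[i]) :
  delay_solution a (q_pot a g alpha) lam Y -> Y 0 0 = 0 -> Y 1 0 = 1 ->
  exists Y', [/\ delay_solution a (q_pot a g beta) lam Y', forall j, Y' j 0 = Y j 0 &
    forall j, Y' j pi = Y j pi].
Proof.
move=> sY Y00 Y10; have [? ? ? ?] := bds.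
have YS t : 0 <= t <= 3 * b -> Y 0 t = S t.
  apply: (delay_solution_start SC _ _ sY) => //; [lra|lra|].
  by move=> x /andP[_ x3]; exact: q_pot_lo.
have [dY acY aeY] := sY.
pose k := beta - alpha.
pose W j := if j == 0 :> 'I_2 then duhamel S C source else duhamel1 lam S C source.
exists (fun j x => Y j x + k * W j x).
have W0 : W 0 = duhamel S C source by [].
have W1 : W 1 = duhamel1 lam S C source by [].
have ck0 y : cont_at setT (fun=> k) y by exact: has_deriv_cont (has_deriv_cst _ _ _).
have dW1 x : has_deriv setT (fun x => k * W 1 x) x (k * (source x - lam * W 0 x)).
  apply: has_deriv_eq (has_derivM (has_deriv_cst _ _ _) (duhamel1_deriv SC x c_source)) _.
  by rewrite W0; ring.
split.
- split.
  + move=> x xp; apply/is_deriv_onP.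
    have /is_deriv_onP H := dY x xp.
    apply: has_derivD => //; rewrite W0 W1.
    have H2 := has_derivM (has_deriv_cst setT k x) (duhamel_deriv SC x c_source).
    apply: has_deriv_eq (has_deriv_sub _ H2) _ => //; ring.
  + apply: acD => //; apply: (C1_ac (pi_ge0 R)) => x _.
      by apply: has_deriv_sub (dW1 x).
    apply: cont_at_sub; apply: cont_atM => //; apply: cont_atD => //.
    apply: cont_atN; apply: cont_atM; last exact: (duhamel_cont SC).
    exact: has_deriv_cont (has_deriv_cst _ _ _).
  + have fil := ae_filter_ringOfSetsType (@lebesgue_measure R).
    move: aeY; apply: (@filterS _ _ fil) => x H xp.
    have [y2 /is_deriv_onP D E] := H xp.
    exists (y2 + k * (source x - lam * W 0 x)).
      by apply/is_deriv_onP; apply: has_derivD => //; exact: has_deriv_sub (dW1 x).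
    have x0p : 0 < x < pi by move: xp; rewrite in_itv.
    have -> : y2 = q_pot a g alpha x * Y 0 (x - a) - lam * Y 0 x by rewrite -E; ring.
    rewrite W0 (correction_sourceE g beta x0p YS).
    move/andP: x0p => [/ltW x0 /ltW xpi].
    rewrite (q_pot_affine hb1 hb2 g alpha) ?x0// [q_pot a g beta _](q_pot_affine hb1 hb2 g beta) ?x0//.
    by rewrite /k; ring.
- move=> j; rewrite /W; have [|H H1] := duhamel_eq0 SC (lexx 0) c_source.
    move=> t; rewrite -eq_le => /eqP <-.
    rewrite /source early_sourceE q_slope_lo ?late_source_eq0 ?mul0r ?addr0//; lra.
  by case: ifP => _; rewrite ?H ?H1 mulr0 addr0.
- move=> j; rewrite /W; have [H H1] := correction_end.
  by case: ifP => _; rewrite ?H ?H1 mulr0 addr0.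
Qed.
End correction.

(** * Spectra and smoothness *)

Section conclusion.
Variables (R : realType) (b : R).
Hypothesis hb1 : pi / 6 <= b.
Hypothesis hb2 : b < pi / 5.
Local Notation l := (pi - 5 * b).
Local Notation a := (2 * b).
Implicit Types (x : R) (g : R -> R[i]) (alpha beta : R[i]).

Let pi0 : 0 < pi :> R. Proof. exact: pi_gt0. Qed.
Let l0 : 0 < l. Proof. by move: hb2; lra. Qed.
Let b0 : 0 < b. Proof. by move: hb1 pi0; lra. Qed.

(** A solution for one parameter exists exactly when one exists for the other; if
    there is none, both characteristic functions take the default value. *)
Lemma char_fun_independent g (j : 'I_2) alpha beta :
  char_fun 0 j a (q_pot a g alpha) = char_fun 0 j a (q_pot a g beta).
Proof.
apply/funext => lam; rewrite /char_fun.
have [S [C SC]] := trig_pair_exists lam.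
pose sols al : set ('I_2 -> R -> R[i]) :=
  [set Y | delay_solution a (q_pot a g al) lam Y /\ forall j, Y j 0 = (1 - 0 == j)%:R].
have tr al be Y : sols al Y -> exists2 Y', sols be Y' & forall j, Y' j pi = Y j pi.
  move=> [sY iY]; have [||Y' [sY' iY' eY']] := shift_delay_solution hb1 hb2 SC be sY.
  - by rewrite iY.
  - by rewrite iY.
  - by exists Y' => //; split => // i; rewrite iY' iY.
have [[Y HY]|nY] := pselect (exists Y, sols alpha Y).
  have [Y' HY' _] := tr _ beta _ HY.
  rewrite /fund_solution.
  have [sY iY] : sols alpha (fund_solution a (q_pot a g alpha) lam (1 - 0)).
    exact: (xgetPex _ (ex_intro _ Y HY)).
  have [sZ iZ] : sols beta (fund_solution a (q_pot a g beta) lam (1 - 0)).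
    exact: (xgetPex _ (ex_intro _ Y' HY')).
  have [Y2 [sY2 iY2] eY2] := tr _ beta _ (conj sY iY).
  rewrite -[LHS]eY2; apply: (delay_solution_unique SC _ sY2 sZ).
  - by move: b0; lra.
  - by move=> i; rewrite iY2 iZ.
  - move=> x /andP[_ xa]; apply: q_pot_lo => //; move: b0; lra.
  - by rewrite lexx ltW.
have nY' : ~ exists Y, sols beta Y.
  by move=> [Y HY]; apply: nY; have [Y' HY' _] := tr _ alpha _ HY; exists Y'.
rewrite /fund_solution !xgetPN// => Y HY; [apply: nY'|apply: nY]; by exists Y.
Qed.

Let W21_real c d (f f' f'' : R -> R) (q : R) (k : R[i]) : c < d ->
  (forall x, rderiv f x (f' x)) -> (forall x, rderiv f' x (f'' x)) ->
  W21 c d (fun x => k * (f (x - q))%:C).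
Proof.
move=> cd df df'.
apply: (@W21_C1 _ _ _ _ (fun x => k * (f' (x - q))%:C)) => // x.
  move=> _; have H := has_derivM (has_deriv_cst setT k x) (rderiv_shift q x df).
  by apply: has_deriv_sub (has_deriv_eq H _) => //; ring.
apply: cont_atM; first exact: has_deriv_cont (has_deriv_cst _ _ _).
exact: has_deriv_cont (rderiv_shift q x df').
Qed.

(** At the break points [3 b], [pi - 2 b], [4 b], [pi - b], [5 b] continuity comes from
    [es 0 = 0], [es l = 0], [Es 0 = 0], [ks l = 0] with the zero of [g], and the
    second boundary value of [g]. *)
Lemma W21_q_pot g alpha : pi / 6 < b -> admissible a g -> W21 0 pi (q_pot a g alpha).
Proof.
move=> hb [Wg g0 g1]; move: hb1 hb2 pi0 l0 b0 => hb1' hb2' pi0' l0' b0'.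
have W0 c d : c < d -> W21 c d (fun=> 0 : R[i]).
  move=> cd; apply: (@W21_C1 _ _ _ _ (fun=> 0)) => // x; first by move=> _; exact: has_deriv_cst.
  exact: has_deriv_cont (has_deriv_cst _ _ _).
apply: (@W21_glue _ 0 (3 * b)); [lra|lra| |apply: (@W21_glue _ _ (pi - 2 * b)); [lra|lra| |
  apply: (@W21_glue _ _ (4 * b)); [lra|lra| |apply: (@W21_glue _ _ (pi - b)); [lra|lra| |
  apply: (@W21_glue _ _ (5 * b)); [lra|lra| |]]]]].
- apply: W21_eq (W0 _ _ _) => // [|x /andP[x0]|]; [lra| |lra].
  rewrite le_eqVlt => /orP[/eqP->|x3]; last by rewrite q_pot_lo.
  by rewrite (q_pot_e hb2) ?subrr ?es_0 ?mulr0//; apply/andP; split; lra.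
- apply: (@W21_eq _ _ _ (fun x => alpha * (es l (x - 3 * b))%:C)); first lra; last first.
    by apply: W21_real (es_deriv l) (es1_deriv l); lra.
  move=> x /andP[x0]; rewrite le_eqVlt => /orP[/eqP->|x3]; last by rewrite (q_pot_e hb2) ?x0.
  rewrite (q_pot_gap hb1 hb2); last by apply/andP; split; lra.
  have -> : pi - 2 * b - 3 * b = l by ring.
  by rewrite es_l ?mulr0.
- apply: W21_eq (W0 _ _ _) => // [|x /andP[x0]|]; [lra| |lra].
  rewrite le_eqVlt => /orP[/eqP->|x3]; last by rewrite (q_pot_gap hb1 hb2) ?x0.
  rewrite (q_pot_kE hb1 hb2); last by apply/andP; split; lra.
  by rewrite subrr Es_0 mulr0.
- have dkE x := rderivM (ks_deriv l x) (Es_deriv l0' x).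
  have dkE' x : rderiv (fun x => - hs l x * Es l x + ks l x * es l x) x
     (- (k_freq l ^+ 2 * ks l x) * Es l x - hs l x * es l x + (- hs l x * es l x + ks l x * es1 l x)).
    have dh : rderiv (fun z => - hs l z) x (- (k_freq l ^+ 2 * ks l x)).
      apply: rderiv_eq; last exact: mulN1r.
      rewrite (_ : (fun z => - hs l z) = (fun z => -1 * hs l z));
        last by apply/funext => z; rewrite mulN1r.
      exact: rderivZ (hs_deriv l x).
    apply: rderiv_eq (rderivD (rderivM dh (Es_deriv l0' x)) (rderivM (ks_deriv l x) (es_deriv l x))) _.
    ring.
  apply: (@W21_eq _ _ _
    (fun x => - alpha * (ks l (x - 4 * b) * Es l (x - 4 * b))%:C)); first lra; last first.
    by apply: (W21_real (f := fun x => ks l x * Es l x)) dkE dkE'; lra.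
  move=> x /andP[x0]; rewrite le_eqVlt => /orP[/eqP->|x3]; last first.
    by rewrite (q_pot_kE hb1 hb2) ?x0// rmorphM mulrA.
  rewrite (q_pot_g hb1 hb2); last by apply/andP; split; lra.
  have -> : pi - b - 4 * b = l by ring.
  have -> : g (pi - b) = 0 by rewrite -g0; congr g; field.
  by rewrite ks_l mul0r mulr0.
- have E1 : pi - a / 2 = pi - b by field.
  have E2 : 5 * a / 2 = 5 * b by field.
  rewrite E1 E2 in Wg; rewrite E2 in g1.
  apply: W21_eq Wg; first lra.
  move=> x /andP[x0]; rewrite le_eqVlt => /orP[/eqP->|x3]; last by rewrite (q_pot_g hb1 hb2) ?x0.
  rewrite (q_pot_h hb1 hb2); last by apply/andP; split; lra.
  rewrite g1 subrr /hs k_ampl_freq // subr0; rewrite /k_freq.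
  move: (pi : R) (Num.sqrt 10 : R) l0' => p r l0'.
  have l2 : p - 5 * b != 0 by rewrite gt_eqF.
  have l3 : 2 * p - 5 * (2 * b) != 0 by rewrite gt_eqF//; lra.
  by congr (_ * cos _)%:C; field; rewrite l2 ?l3.
- apply: (@W21_eq _ _ _ (fun x => 1 * (hs l (x - 5 * b))%:C)); first lra; last first.
    by apply: W21_real (hs_deriv l) (fun x => rderivZ _ (ks_deriv l x)); lra.
  by move=> x /andP[x0 x1]; rewrite (q_pot_h hb1 hb2) ?x0 ?mul1r.
Qed.
End conclusion.

Theorem theorem2 (R : realType) (a : R) (g : R -> R[i])
    (ha : pi / 3 <= a < 2 * pi / 5)
    (hg : pi / 3 < a -> admissible a g) :
  (forall (j : 'I_2) (alpha beta : R[i]),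
     spectrum 0 j a (q_pot a g alpha) = spectrum 0 j a (q_pot a g beta)) /\
  (pi / 3 < a -> B0 a g `<=` W21 0 pi).
Proof.
have [b ab] : exists b, a = 2 * b by exists (a / 2); field.
move: ha hg; rewrite {}ab => /andP[h1 h2] hg.
have hb1 : pi / 6 <= b by lra.
have hb2 : b < pi / 5 by lra.
split.
  by move=> j alpha beta; rewrite /spectrum (char_fun_independent hb1 hb2 g j alpha beta).
move=> h q [alpha _ <-]; apply: W21_q_pot => //; last exact: hg.
lra.
Qed.
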